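(* Consider the alternative hypothesis $H_1$: there exists a constant $u_*\in(0,1)$ such that the true parameter value is $\theta_0\in\Theta$ for $u\in[0,u_*]$ and $\theta_1\in\Theta$ for $u\in(u_*,1]$, where $\theta_0\neq\theta_1$; that is, for each $n$ the observations $X_1,\ldots,X_n$ are independent with $X_k\sim P_{\theta_0}$ for $k\le[u_*n]$ and $X_k\sim P_{\theta_1}$ for $[u_*n]<k\le n$. Let $$\mathcal{T}_n(u)=\left|n\,\mathbb{Z}_n(u,\widehat\theta_n)^\top\,\widehat\Sigma_n^{-1}\,\mathbb{Z}_n(u,\widehat\theta_n)\right|,\quad u\in[0,1],\qquad \hat u_n=\arg\max_{u\in[0,1]}\mathcal{T}_n(u).$$ Under $H_1$, $\hat u_n$ converges in probability to $u_*$ as $n\to\infty$.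
   Context: The parameter space $\Theta\subset\mathbb{R}^d$ is bounded, open and convex, and $\{P_\theta:\theta\in\Theta\}$ is a family of probability distributions on a measurable space $(\mathcal{X},\mathcal{A})$ with densities $f(\cdot;\theta)$ with respect to a measure $\mu$. Let $\psi:\mathcal{X}\to\mathbb{R}^d$ be a measurable function. With $X\sim P_\theta$ under $E_\theta$, put $e(\theta)=E_\theta[\psi(X)]\in\mathbb{R}^d$, $\Sigma(\theta)=E_\theta[(\psi(X)-e(\theta))(\psi(X)-e(\theta))^\top]$, and let $V(\theta)=\left[\frac{\partial}{\partial\theta_j}e^{(i)}(\theta)\right]_{i,j=1,\ldots,d}$ be the derivative matrix of $e$. For $u\in[0,1]$ and $\theta\in\Theta$, $$\mathbb{Z}_n(u,\theta)=\frac1n\sum_{k=1}^{[un]}(\psi(X_k)-e(\theta)),$$ where $[\cdot]$ denotes the integer part. The method of moments estimator $\widehat\theta_n$ is the solution of $\mathbb{Z}_n(1,\widehat\theta_n)=0$, i.e. $e(\widehat\theta_n)=\frac1n\sum_{k=1}^n\psi(X_k)$. Moreover $$\widehat\Sigma_n=\frac1n\sum_{k=1}^n(\psi(X_k)-e(\widehat\theta_n))(\psi(X_k)-e(\widehat\theta_n))^\top .$$ *)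

(* Defs.v *)
From HB Require Import structures.
From mathcomp Require Import all_boot all_order all_algebra.
From mathcomp Require Import all_classical all_reals all_analysis.

Set Implicit Arguments.
Unset Strict Implicit.
Unset Printing Implicit Defensive.
Import Order.TTheory GRing.Theory Num.Def Num.Theory.
Import numFieldNormedType.Exports.

Local Open Scope classical_set_scope.
Local Open Scope ring_scope.

(* e(theta) = E_theta[psi(X)] *)
Definition moment (R : realType) (d : nat) (dX : measure_display)
    (X : measurableType dX) (P : 'cV[R]_d -> probability X R)
    (psi : X -> 'cV[R]_d) (theta : 'cV[R]_d) : 'cV[R]_d :=
  \col_i \int[P theta]_x psi x i 0.

(* The family is a total function of theta, but it is constrained on Theta     *)
(* only.                                                                       *)
Record moment_model (R : realType) (d : nat) (dX : measure_display)
    (X : measurableType dX) (mu : {measure set X -> \bar R})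
    (Theta : set 'cV[R]_d) (P : 'cV[R]_d -> probability X R)
    (f : 'cV[R]_d -> X -> R) (psi : X -> 'cV[R]_d) : Prop := MomentModel {
  mm_bounded : bounded_set Theta ;
  mm_open : open Theta ;
  mm_convex : convex_set (Theta : set (convex_lmodType 'cV[R]_d)) ;
  mm_density_ge0 : forall theta, Theta theta -> forall x, 0 <= f theta x ;
  mm_density_measurable : forall theta, Theta theta ->
    measurable_fun [set: X] (f theta) ;
  mm_density : forall theta, Theta theta -> forall A : set X, measurable A ->
    P theta A = (\int[mu]_(x in A) (f theta x)%:E)%E ;
  mm_psi_measurable : forall i, measurable_fun [set: X] (fun x => psi x i 0) ;
  (* e(theta) and Sigma(theta) are well defined *)
  mm_mean : forall theta, Theta theta -> forall i,
    (P theta).-integrable [set: X] (fun x => (psi x i 0)%:E) ;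
  mm_covariance : forall theta, Theta theta -> forall i j,
    (P theta).-integrable [set: X]
      (fun x => (((psi x - moment P psi theta)
                  *m (psi x - moment P psi theta)^T) i j)%:E) ;
  (* the partial derivatives forming V(theta) exist *)
  mm_derivable : forall theta, Theta theta -> forall i j,
    derivable (fun t : 'cV[R]_d => moment P psi t i 0) theta (delta_mx j 0) ;
  (* a moment equation e(theta) = m has at most one solution in Theta *)
  mm_inj : forall theta theta', Theta theta -> Theta theta' ->
    moment P psi theta = moment P psi theta' -> theta = theta' }.

(* Statistics of a sample x 1, ..., x n (index 0 is unused). *)
Section statistics.
Variables (R : realType) (d : nat) (dX : measure_display).
Variables (X : measurableType dX) (P : 'cV[R]_d -> probability X R).
Variables (psi : X -> 'cV[R]_d) (x : nat -> X) (n : nat).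

(* Num.truncn is the integer part of a nonnegative number. *)
Definition Zn (u : R) (theta : 'cV[R]_d) : 'cV[R]_d :=
  n%:R^-1 *: \sum_(1 <= k < (truncn (u * n%:R)).+1)
    (psi (x k) - moment P psi theta).

Definition Sigma_hat (theta : 'cV[R]_d) : 'M[R]_d :=
  n%:R^-1 *: \sum_(1 <= k < n.+1)
    ((psi (x k) - moment P psi theta) *m (psi (x k) - moment P psi theta)^T).

(* invmx is the identity on singular matrices. *)
Definition Tn (theta : 'cV[R]_d) (u : R) : R :=
  `| n%:R * ((Zn u theta)^T *m invmx (Sigma_hat theta) *m Zn u theta) 0 0 |.

End statistics.

(* Stated through measurable subevents, so that A n itself need not be         *)
(* measurable.                                                                 *)
Definition with_probability_tending_to_1 (R : realType) (dO : measure_display)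
    (Omega : measurableType dO) (Pr : probability Omega R)
    (A : nat -> set Omega) : Prop :=
  exists B : nat -> set Omega,
    [/\ forall n, measurable (B n), forall n, B n `<=` A n
      & Pr (B n) @[n --> \oo] --> 1%E].

Definition cvg_in_probability (R : realType) (dO : measure_display)
    (Omega : measurableType dO) (Pr : probability Omega R)
    (Y : nat -> {RV Pr >-> R}) (c : R) : Prop :=
  forall eps : R, 0 < eps ->
    Pr [set w | eps <= `|Y n w - c|] @[n --> \oo] --> 0%E.

(* Mutual independence of Y 1, ..., Y n; the product rule for subfamilies is   *)
(* the case where some of the A k are the whole space.                         *)
Definition independent_upto (R : realType) (dO dX : measure_display)
    (Omega : measurableType dO) (X : measurableType dX)
    (Pr : probability Omega R) (n : nat) (Y : nat -> {RV Pr >-> X}) : Prop :=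
  forall A : nat -> set X, (forall k, measurable (A k)) ->
    Pr [set w | forall k, (1 <= k <= n)%N -> A k (Y k w)] =
    (\prod_(1 <= k < n.+1) Pr (Y k @^-1` A k))%E.

(* The observations form a triangular array: the n-th sample is obs n 1, ...,  *)
(* obs n n, as the law of the k-th observation depends on n.                   *)
Record change_point_alternative (R : realType) (d : nat)
    (dO dX : measure_display) (Omega : measurableType dO)
    (X : measurableType dX) (Pr : probability Omega R)
    (P : 'cV[R]_d -> probability X R) (obs : nat -> nat -> {RV Pr >-> X})
    (ustar : R) (theta0 theta1 : 'cV[R]_d) : Prop := ChangePointAlternative {
  cp_indep : forall n, independent_upto n (obs n) ;
  cp_before : forall n k, (1 <= k <= n)%N -> (k <= truncn (ustar * n%:R))%N ->
    forall A : set X, measurable A ->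
      distribution Pr (obs n k) A = P theta0 A ;
  cp_after : forall n k, (1 <= k <= n)%N -> (truncn (ustar * n%:R) < k)%N ->
    forall A : set X, measurable A ->
      distribution Pr (obs n k) A = P theta1 A }.

(* The estimators theta_hat n need not be measurable. They lie in Theta and    *)
(* solve Z_n(1, theta) = 0 on events whose probability tends to 1; for finite  *)
(* n a solution may fail to exist with positive probability.                   *)
Definition moment_estimator (R : realType) (d : nat) (dO dX : measure_display)
    (Omega : measurableType dO) (X : measurableType dX)
    (Pr : probability Omega R) (Theta : set 'cV[R]_d)
    (P : 'cV[R]_d -> probability X R) (psi : X -> 'cV[R]_d)
    (obs : nat -> nat -> {RV Pr >-> X})
    (theta_hat : nat -> Omega -> 'cV[R]_d) : Prop :=
  with_probability_tending_to_1 Pr (fun n => [set w |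
    Theta (theta_hat n w) /\
    Zn P psi (fun k => obs n k w) n 1 (theta_hat n w) = 0]).

(* The maximiser over [0, 1] is not unique, T_n being a step function of u:    *)
(* u_hat n may be any measurable choice of it.                                 *)
Definition change_point_estimator (R : realType) (d : nat)
    (dO dX : measure_display) (Omega : measurableType dO)
    (X : measurableType dX) (Pr : probability Omega R)
    (P : 'cV[R]_d -> probability X R) (psi : X -> 'cV[R]_d)
    (obs : nat -> nat -> {RV Pr >-> X}) (theta_hat : nat -> Omega -> 'cV[R]_d)
    (u_hat : nat -> {RV Pr >-> R}) : Prop :=
  forall n w, (0 < n)%N ->
    u_hat n w \in `[0, 1] /\
    forall u, u \in `[0, 1] ->
      Tn P psi (fun k => obs n k w) n (theta_hat n w) u <=
      Tn P psi (fun k => obs n k w) n (theta_hat n w) (u_hat n w).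

(* Main.v *)
(* Let tau be the change point, e0 and e1 the two means of psi, D = e0 - e1 and
   M = tau e0 + (1 - tau) e1.  On the event Z_n(1, theta_hat) = 0 the vector
   e(theta_hat) is the sample mean of psi.  A weak law of large numbers, uniform over partial sums, gives
   Z_n(u, theta_hat) = (min(u, tau) - u tau) D + o(1) uniformly in u, and
   Sigma_hat converges to the mixture
   S = tau E_0[(psi - M)(psi - M)^T] + (1 - tau) E_1[(psi - M)(psi - M)^T].
   The matrix invmx Sigma_hat has a limit Q with D^T Q D > 0 in all cases:  if S
   is invertible then Q = S^-1; if y^T S = 0 with y <> 0, then y^T (psi - M)
   vanishes almost surely under both laws, hence Sigma_hat is almost surely
   singular, invmx Sigma_hat = Sigma_hat, and Q = S.  Thus T_n(u) / n is
   uniformly close to (min(u, tau) - u tau)^2 D^T Q D, which has a sharp maximum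
   at tau. *)

Require Import Defs.
From mathcomp Require Import all_boot all_order all_algebra.
From mathcomp Require Import all_classical all_reals all_analysis.
From mathcomp Require Import measurable_realfun.
From mathcomp Require Import ring lra.
Import Order.TTheory GRing.Theory Num.Theory.
Import numFieldNormedType.Exports HBSimple.
Local Open Scope classical_set_scope.
Local Open Scope ring_scope.

(** * Events of probability tending to 1, and Markov's inequality *)

Lemma measurable_superlevel {R : realType} {d : measure_display}
    {T : measurableType d} (f : T -> R) (a : R) :
  measurable_fun [set: T] f -> measurable [set x | a <= f x].
Proof.
move=> mf; rewrite (_ : [set x | _] = f @^-1` `[a, +oo[%classic); last first.
  by apply/seteqP; split=> x /=; rewrite in_itv/= andbT.
by rewrite -[X in measurable X]setTI; exact: mf.
Qed.

Section high_probability.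
Context {R : realType} {dO : measure_display} {Omega : measurableType dO}.
Variable Pr : probability Omega R.

(* Events whose probability tends to 1 form a filter on pairs (n, w), so that
   convergence in probability is convergence along it.  Exceptional sets make
   measurability of the events themselves irrelevant. *)
Definition whp : set_system (nat * Omega) := fun A =>
  forall eta : R, 0 < eta -> \forall n \near \oo,
    exists C : set Omega, [/\ measurable C, (Pr C <= eta%:E)%E
      & forall w, ~ C w -> A (n, w)].

Lemma whp_at_infty (A : set nat) :
  (\forall n \near \oo, A n) -> \forall p \near whp, A p.1.
Proof.
move=> hA eta eta0; move: hA; apply: filterS => n An; exists set0.
by split=> //; rewrite measure0 lee_fin ltW.
Qed.

Global Instance whp_filter : Filter whp.
Proof.
split.
- by apply: (@whp_at_infty setT); apply: nearW.
- move=> A B hA hB eta eta0; have eta20 : 0 < eta / 2 by lra.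
  apply: (@filterS2 _ eventually _ _ _ _ _ (hA _ eta20) (hB _ eta20)).
  move=> n [C [mC PC hC]] [D [mD PD hD]]; exists (C `|` D); split.
  + exact: measurableU.
  + apply: (le_trans (measureU2 _ mC mD)).
    by rewrite [eta]splitr EFinD leeD.
  + by move=> w /= /not_orP[nC nD]; split; [exact: hC|exact: hD].
- move=> A B AB hA eta eta0; apply: (@filterS _ eventually _ _ _ _ (hA _ eta0)).
  move=> n [C [mC PC hC]].
  by exists C; split=> // w nC; apply/AB/hC.
Qed.

Lemma whp_tending_to_1 {A : nat -> set Omega} :
  with_probability_tending_to_1 Pr A -> \forall p \near whp, A p.1 p.2.
Proof.
move=> [B [mB BA B1]] eta eta0.
move: B1 => /fine_cvgP[_ /cvgrPdist_lt/(_ _ eta0) h].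
apply: (@filterS _ eventually _ _ _ _ h) => n /= {h} /ltW.
move=> /(le_trans (ler_norm _)) h.
exists (~` B n); split=> [||w /contrapT/BA//]; first exact: measurableC.
rewrite probability_setC// -[X in (1 - X)%E]fineK ?fin_num_measure//.
Qed.

(** Measurability of [Y n] makes the deviation event measurable. Off the exceptional set it cannot
    occur, so monotonicity of [Pr] bounds its probability. *)
Lemma whp_cvg_in_probability (Y : nat -> {RV Pr >-> R}) (c : R) :
  Y p.1 p.2 @[p --> whp] --> c -> cvg_in_probability Y c.
Proof.
move=> Yc eps eps0.
have m n : measurable [set w | eps <= `|Y n w - c|].
  apply: measurable_superlevel; apply: measurableT_comp => //.
  exact: measurable_funB.
apply/fine_cvgP; split; first by apply: nearW => n; rewrite fin_num_measure.
apply/cvgr0Pnorm_le => eta eta0.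
move: Yc => /cvgrPdist_lt/(_ _ eps0 _ eta0) h.
apply: (@filterS _ eventually _ _ _ _ h) => n {h} [C [mC PC hC]].
rewrite ger0_norm ?fine_ge0//= -lee_fin fineK ?fin_num_measure//.
apply: le_trans PC; apply: le_measure; rewrite ?inE// => w /=.
by rewrite distrC leNgt => /negP h; apply: contrapT => /hC /=.
Qed.

(** Markov's inequality, packaged with measurability of the event so that the event can serve
    directly as an exceptional set for [whp]. *)
Lemma markov_bound (f : Omega -> R) (a b : R) :
  measurable_fun [set: Omega] f -> (forall w, 0 <= f w) -> 0 < a ->
  (\int[Pr]_w (f w)%:E <= b%:E)%E ->
  measurable [set w | a <= f w] /\
  (Pr [set w | (a <= f w)%R] <= (b / a)%:E)%E.
Proof.
move=> mf f0 a0 fb; have mA := measurable_superlevel f a mf.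
split=> //; rewrite EFinM muleC -lee_pdivrMl ?invr_gt0// invrK.
apply: le_trans fb.
have mEf : measurable_fun [set: Omega] (EFin \o f) by exact/measurable_EFinP.
have := le_integral_abse Pr measurableT mEf a0.
rewrite setTI; under eq_integral do rewrite /= ger0_norm//.
congr (_ * Pr _ <= _)%E; apply/seteqP; split=> w /=;
  by rewrite ger0_norm ?lee_fin.
Qed.

End high_probability.

(** * Linearity of real-valued integrals *)

Section real_integral.
Context {R : realType} {d : measure_display} {T : measurableType d}.

Lemma integrable_EFinD (mu : measure T R) (f g : T -> R) :
  mu.-integrable [set: T] (EFin \o f) -> mu.-integrable [set: T] (EFin \o g) ->
  mu.-integrable [set: T] (EFin \o (fun x => f x + g x)).
Proof. by move=> fi gi; apply: integrableD fi gi. Qed.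

Lemma integrable_EFinB (mu : measure T R) (f g : T -> R) :
  mu.-integrable [set: T] (EFin \o f) -> mu.-integrable [set: T] (EFin \o g) ->
  mu.-integrable [set: T] (EFin \o (fun x => f x - g x)).
Proof. by move=> fi gi; apply: integrableB fi gi. Qed.

Lemma integrable_EFinZl (mu : measure T R) (k : R) (f : T -> R) :
  mu.-integrable [set: T] (EFin \o f) ->
  mu.-integrable [set: T] (EFin \o (fun x => k * f x)).
Proof. by move=> fi; apply: integrableZl fi. Qed.

Lemma integrable_EFin_sum {I : eqType} (mu : measure T R) (s : seq I)
    (f : I -> T -> R) :
  (forall i, mu.-integrable [set: T] (EFin \o f i)) ->
  mu.-integrable [set: T] (EFin \o (fun x => \sum_(i <- s) f i x)).
Proof.
move=> fi; rewrite (_ : _ \o _ = fun x => (\sum_(i <- s) (f i x)%:E)%E).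
  by apply: integrable_sum => // i _; exact: fi.
by apply/funext => x /=; rewrite sumEFin.
Qed.

Lemma Rintegral_sum {I : eqType} (mu : measure T R) (s : seq I)
    (f : I -> T -> R) :
  (forall i, mu.-integrable [set: T] (EFin \o f i)) ->
  \int[mu]_x (\sum_(i <- s) f i x) = \sum_(i <- s) \int[mu]_x f i x.
Proof.
move=> fi; elim: s => [|a s IH].
  under eq_Rintegral do rewrite big_nil.
  by rewrite big_nil Rintegral_cst// mul0r.
under eq_Rintegral do rewrite big_cons.
by rewrite big_cons -IH RintegralD//; exact: integrable_EFin_sum.
Qed.

Lemma Rintegral_indic (mu : measure T R) (A : set T) :
  measurable A -> \int[mu]_x \1_A x = fine (mu A).
Proof. by move=> mA; rewrite /Rintegral integral_indic// setIT. Qed.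

Lemma Rintegral_cst_probability (P : probability T R) (r : R) :
  \int[P]_x (fun=> r) x = r.
Proof.
rewrite Rintegral_cst// (_ : fine _ = 1) ?mulr1//.
by rewrite -[1]/(fine 1%E); congr fine; exact: probability_setT.
Qed.

Lemma integral_fin_Rintegral (mu : measure T R) (f : T -> R) :
  mu.-integrable [set: T] (EFin \o f) ->
  (\int[mu]_x (f x)%:E)%E = (\int[mu]_x f x)%:E.
Proof. by move=> fi; rewrite fineK//; exact: integrable_fin_num. Qed.

End real_integral.

(** * Variance of sums of pairwise independent indicators *)

Section indicator_variance.
Context {R : realType} {dO : measure_display} {Omega : measurableType dO}.
Variable Pr : probability Omega R.

Let pr (B : set Omega) : R := fine (Pr B).
Let D (B : set Omega) (w : Omega) : R := \1_B w - pr B.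

Lemma fine_probability01 (B : set Omega) : measurable B -> 0 <= pr B <= 1.
Proof.
move=> mB; rewrite fine_ge0//= -lee_fin fineK ?fin_num_measure//.
exact: probability_le1.
Qed.

Lemma norm_centered_indic_le1 (B : set Omega) w : measurable B -> `|D B w| <= 1.
Proof.
move=> /fine_probability01 /andP[p0 p1]; rewrite /D indicE ler_norml.
by case: (w \in B) => /=; apply/andP; split; lra.
Qed.

Lemma measurable_centered_indic (B : set Omega) :
  measurable B -> measurable_fun [set: Omega] (D B).
Proof. by move=> mB; apply: measurable_funB. Qed.

Lemma integrable_centered_indicM (B C : set Omega) :
  measurable B -> measurable C ->
  Pr.-integrable [set: Omega] (EFin \o (fun w => D B w * D C w)).
Proof.
move=> mB mC; apply: measurable_bounded_integrable => //.
- by rewrite (le_lt_trans (probability_le1 Pr measurableT)) ?ltry.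
- by apply: measurable_funM; exact: measurable_centered_indic.
- exists 1; split=> // r r1 w _ /=; rewrite normrM (le_trans _ (ltW r1))//.
  by rewrite mulr_ile1// norm_centered_indic_le1.
Qed.

Lemma covariance_indic (B C : set Omega) : measurable B -> measurable C ->
  \int[Pr]_w (D B w * D C w) = pr (B `&` C) - pr B * pr C.
Proof.
move=> mB mC; have mBC := measurableI _ _ mB mC.
have E w : D B w * D C w =
    (\1_(B `&` C) w - pr B * \1_C w) - (pr C * \1_B w - pr B * pr C).
  by rewrite /D indicI /=; ring.
have iI A : measurable A -> Pr.-integrable [set: Omega] (EFin \o \1_A).
  exact: integrable_indic.
have iZ A r : measurable A ->
    Pr.-integrable [set: Omega] (EFin \o (fun w => r * \1_A w)).
  by move=> mA; apply: integrable_EFinZl; exact: iI.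
have iC r : Pr.-integrable [set: Omega] (EFin \o (fun=> r)).
  exact: finite_measure_integrable_cst.
under eq_Rintegral do rewrite E.
rewrite RintegralB//; last 2 first.
- by apply: integrable_EFinB; [exact: iI|exact: iZ].
- by apply: integrable_EFinB; [exact: iZ|exact: iC].
rewrite RintegralB//; first last.
- by apply: iZ.
- by apply: iI.
rewrite RintegralB//; last by apply: iZ.
rewrite !RintegralZl//; try exact: iI.
by rewrite !Rintegral_indic// Rintegral_cst_probability /pr; ring.
Qed.

(** The square expands into covariances: off the diagonal they vanish by pairwise independence, and
    each diagonal one has the form p - p^2 with p in [0, 1], hence is at most 1. *)
Lemma variance_sum_indic_le (I : eqType) (r : seq I) (B : I -> set Omega) :
  uniq r -> (forall i, measurable (B i)) ->
  (forall i j, i \in r -> j \in r -> i != j ->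
    pr (B i `&` B j) = pr (B i) * pr (B j)) ->
  (\int[Pr]_w ((\sum_(i <- r) D (B i) w) ^+ 2)%:E <= (size r)%:R%:E)%E.
Proof.
move=> ur mB ind.
have E w : (\sum_(i <- r) D (B i) w) ^+ 2 =
    \sum_(i <- r) \sum_(j <- r) D (B i) w * D (B j) w.
  by rewrite expr2 mulr_suml; under eq_bigr do rewrite mulr_sumr.
have iD i : Pr.-integrable [set: Omega]
    (EFin \o (fun w => \sum_(j <- r) D (B i) w * D (B j) w)).
  by apply: integrable_EFin_sum => j; exact: integrable_centered_indicM.
under eq_integral do rewrite E.
rewrite integral_fin_Rintegral; last exact: integrable_EFin_sum.
rewrite lee_fin Rintegral_sum//.
have -> : (size r)%:R = \sum_(i <- r) (1 : R).
  by rewrite big_const_seq count_predT iter_addr addr0.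
rewrite big_seq [leRHS]big_seq; apply: ler_sum => i ir.
rewrite Rintegral_sum; last by move=> j; exact: integrable_centered_indicM.
rewrite (bigD1_seq i)//= big_seq_cond big1 ?addr0; last first.
  by move=> j /andP[jr ji]; rewrite covariance_indic// ind ?subrr// eq_sym.
rewrite covariance_indic// setIid.
have /andP[p0 p1] := fine_probability01 _ (mB i).
by rewrite lerBlDr (le_trans p1)// lerDl mulr_ge0.
Qed.

End indicator_variance.

(** * Weak law of large numbers, uniform over partial sums *)

Section uniform_lln.
Context {R : realType} {dO dX : measure_display} {Omega : measurableType dO}.
Context {X : measurableType dX} {Pr : probability Omega R}.
Variables (obs : nat -> nat -> {RV Pr >-> X}) (Q0 Q1 : probability X R).
Variable K : nat -> nat.

(** [K n] plays the role of the last index before the change in the n-th sample; it stays arbitrary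
    throughout this section. *)
Definition law (n k : nat) : probability X R :=
  if (k <= K n)%N then Q0 else Q1.

Hypothesis indep : forall n, independent_upto n (obs n).
Hypothesis obs_law : forall n k, (1 <= k <= n)%N ->
  forall A : set X, measurable A -> distribution Pr (obs n k) A = law n k A.

Definition deviation (g : X -> R) (n m : nat) (w : Omega) : R :=
  \sum_(1 <= k < m.+1) (g (obs n k w) - \int[law n k]_x g x).

(** The quantifier over [m] sits inside the event: a single exceptional set serves all partial sums,
    so that [m] may later be a random index. *)
Definition ulln (g : X -> R) : Prop :=
  forall e : R, 0 < e -> \forall p \near whp Pr,
    forall m, (m <= p.1)%N -> `|deviation g p.1 m p.2| <= e * p.1%:R.

Lemma measurable_obs (g : X -> R) n k : measurable_fun [set: X] g ->
  measurable_fun [set: Omega] (fun w => g (obs n k w)).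
Proof. by move=> mg; apply: measurableT_comp. Qed.

Lemma measurable_deviation (g : X -> R) n m : measurable_fun [set: X] g ->
  measurable_fun [set: Omega] (deviation g n m).
Proof.
move=> mg; apply: measurable_sum => k; apply: measurable_funB => //.
exact: measurable_obs.
Qed.

Lemma measurable_obs_preimage n k (A : set X) :
  measurable A -> measurable (obs n k @^-1` A).
Proof.
move=> mA; rewrite -[X in measurable X]setTI.
exact: (measurable_funPT (obs n k)).
Qed.

Lemma pairwise_independence n j k (A : set X) : measurable A ->
  (1 <= j <= n)%N -> (1 <= k <= n)%N -> j != k ->
  (Pr (obs n j @^-1` A `&` obs n k @^-1` A) =
   Pr (obs n j @^-1` A) * Pr (obs n k @^-1` A))%E.
Proof.
move=> mA jn kn jk.
(* Mutual independence is applied with [A] at the two chosen indices and the whole space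
   elsewhere. *)
pose A' i := if (i == j) || (i == k) then A else [set: X].
have mA' i : measurable (A' i) by rewrite /A'; case: ifP.
have := indep n A' mA'.
rewrite (_ : [set w | _] = obs n j @^-1` A `&` obs n k @^-1` A); last first.
  apply/seteqP; split=> w /=.
  - move=> h; have := h j jn; have := h k kn; rewrite /A' !eqxx orbT /=.
    by split.
  - move=> [hj hk] i _; rewrite /A'; case: eqP => [->|_]//=.
    by case: eqP => [->|].
move=> ->.
(* The product splits into two products, each with a single factor that may differ from 1. *)
pose f l i := if i == l then Pr (obs n l @^-1` A) else 1%E.
rewrite (eq_bigr (fun i => (f j i * f k i)%E)); last first.
  move=> i _; rewrite /f /A'; have [->|ij] := eqVneq i j.
    by rewrite (negbTE jk) mule1.
  have [->|ik] := eqVneq i k; rewrite mul1e//=.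
  by rewrite preimage_setT probability_setT.
have prodf l : (1 <= l <= n)%N ->
    (\prod_(1 <= i < n.+1) f l i = Pr (obs n l @^-1` A))%E.
  move=> ln; rewrite (bigD1_seq l) ?iota_uniq ?mem_index_iota ?ltnS//=.
  rewrite big1 ?mule1 /f ?eqxx// => i /negbTE il.
  by rewrite il.
by rewrite big_split /= !prodf.
Qed.

Lemma Rintegral_indic_law n k (A : set X) : (1 <= k <= n)%N -> measurable A ->
  \int[law n k]_x \1_A x = fine (Pr (obs n k @^-1` A)).
Proof.
move=> kn mA; rewrite Rintegral_indic//; congr fine.
exact/esym/(obs_law _ _ kn _ mA).
Qed.

Lemma deviation_indic_second_moment n m (A : set X) :
  measurable A -> (m <= n)%N ->
  (\int[Pr]_w ((deviation \1_A n m w) ^+ 2)%:E <= m%:R%:E)%E.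
Proof.
move=> mA mn.
have mB k := measurable_obs_preimage n k A mA.
have -> : (m = size (index_iota 1 m.+1))%N by rewrite size_iota subn1.
have := @variance_sum_indic_le _ _ _ Pr _ (index_iota 1 m.+1)
  (fun k => obs n k @^-1` A) (iota_uniq _ _) mB.
rewrite size_iota subn1 /=.
have -> : (fun w : Omega => ((deviation \1_A n m w) ^+ 2)%:E) =
    (fun w : Omega => ((\sum_(1 <= k < m.+1)
      (\1_(obs n k @^-1` A) w - fine (Pr (obs n k @^-1` A)))) ^+ 2)%:E).
  apply/funext => w; congr ((_ ^+ 2)%:E); apply: eq_big_seq => k.
  rewrite mem_index_iota ltnS => /andP[k1 km].
  by rewrite Rintegral_indic_law// k1 (leq_trans km).
apply=> i j; rewrite !mem_index_iota !ltnS => /andP[i1 im] /andP[j1 jm] ij.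
rewrite pairwise_independence ?i1 ?j1 ?(leq_trans im) ?(leq_trans jm)//.
by rewrite fineM// fin_num_measure.
Qed.

(** Each centered indicator is at most 1 in absolute value, so a partial sum moves by at most the
    number of added terms. *)
Lemma deviation_indic_increment n (A : set X) m m' w : measurable A ->
  (m' <= m)%N -> (m <= n)%N ->
  `|deviation \1_A n m w| <= `|deviation \1_A n m' w| + (m - m')%:R.
Proof.
move=> mA m'm mn.
rewrite {1}/deviation (big_cat_nat (n:=m'.+1))//= -/(deviation \1_A n m' w).
rewrite (le_trans (ler_normD _ _))// lerD2l (le_trans (ler_norm_sum _ _ _))//.
apply: (@le_trans _ _ (\sum_(m'.+1 <= k < m.+1) (1 : R))); last first.
  by rewrite big_const_nat iter_addr addr0 subSS.
rewrite big_nat [leRHS]big_nat; apply: ler_sum => k /andP[k1 km].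
rewrite Rintegral_indic_law//; last first.
  by rewrite (leq_trans _ k1)//= -ltnS (leq_trans km)// ltnS.
have := norm_centered_indic_le1 Pr _ w (measurable_obs_preimage n k A mA).
by rewrite !indicE.
Qed.

(* The partial sums are controlled by Chebyshev on a grid of [M] times, and
   move by at most the mesh [n / M + 1] between grid points. *)
Lemma ulln_indic (A : set X) : measurable A -> ulln \1_A.
Proof.
move=> mA e e0 eta eta0.
(* As M > 4 / e, the mesh n / M + 1 is at most e n / 4 + 1, which [n1] below bounds by e n / 2, that
   is, by [a]. *)
pose M := (Num.truncn (4 / e)).+1.
have Me : 4 / e < M%:R by exact: truncnS_gt.
have M0 : 0 < M%:R :> R by rewrite ltr0n.
near=> n.
have n0 : 0 < n%:R :> R by rewrite ltr0n; near: n; exists 1%N.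
have n1 : 4 / e <= n%:R by near: n; exact: nbhs_infty_ger.
(* Chebyshev at [M] grid points costs M n / a^2 = 4 M / (e^2 n), which this lower bound on n keeps
   below [eta]. *)
have n2 : 4 * M%:R / (e ^+ 2 * eta) <= n%:R by near: n; exact: nbhs_infty_ger.
pose B := (n %/ M).+1.
pose a := e * n%:R / 2.
have a0 : 0 < a by rewrite divr_gt0// mulr_gt0.
(* [B] is rounded up, so the last grid points may exceed n; [minn] keeps them inside the sample. *)
pose C j := [set w | a ^+ 2 <= (deviation \1_A n (minn (j * B) n) w) ^+ 2].
have Cj j : measurable (C j) /\ (Pr (C j) <= (n%:R / a ^+ 2)%:E)%E.
  apply: markov_bound.
  - apply: measurable_funX; apply: measurable_deviation.
    exact: measurable_indic.
  - by move=> w; exact: sqr_ge0.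
  - by rewrite exprn_gt0.
  - apply: (le_trans (deviation_indic_second_moment _ _ _ mA _)).
      exact: geq_minr.
    by rewrite lee_fin ler_nat geq_minr.
exists (\big[setU/set0]_(j < M) C j); split.
- by apply: bigsetU_measurable => i _; case: (Cj i).
- apply: (le_trans (Boole_inequality _ _)) => [i _|]; first by case: (Cj i).
  apply: (@le_trans _ _ (\sum_(j < M) (n%:R / a ^+ 2)%:E)%E).
    by apply: lee_sum => j _; case: (Cj j).
  rewrite sumEFin lee_fin big_const_ord iter_addr addr0 -[leLHS]mulr_natr.
  rewrite /a; move: n2; rewrite ler_pdivrMr ?mulr_gt0 ?exprn_gt0// => n2.
  rewrite mulrAC ler_pdivrMr ?exprn_gt0 ?divr_gt0 ?mulr_gt0//.
  rewrite [leRHS](_ : _ = n%:R * (n%:R * (e ^+ 2 * eta)) / 4); last by field.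
  rewrite ler_pdivlMr// -mulrA ler_pM2l//; lra.
- move=> w nC m /= mn.
  (* The last grid point not beyond [m] is [j * B]; rounding [B] up ensures [j < M]. *)
  pose j := (m %/ B)%N.
  have jM : (j < M)%N.
    rewrite ltn_divLR// (leq_ltn_trans mn)// mulnC -ltn_divLR//.
  have jm : (j * B <= m)%N by exact: leq_trunc_div.
  have hj : `|deviation \1_A n (j * B) w| < a.
    rewrite ltNge; apply/negP => h; apply: nC.
    rewrite -bigcup_mkord; exists j => //=.
    rewrite /C /= (minn_idPl (leq_trans jm mn)).
    rewrite -[leRHS]real_normK ?num_real//.
    by apply: lerXn2r; rewrite ?nnegrE ?(ltW a0).
  apply: (le_trans (deviation_indic_increment _ _ _ _ w mA jm mn)).
  have mB : (m - j * B <= B)%N by rewrite {1}(divn_eq m B) addKn ltnW// ltn_mod.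
  have BR : B%:R <= a.
    have h : (n %/ M)%:R * M%:R <= n%:R :> R.
      by rewrite -natrM ler_nat leq_trunc_div.
    rewrite /B -natr1 /a; move: Me n1; rewrite !ltr_pdivrMr// !ler_pdivrMr//.
    move=> Me n1; have h2 : (n %/ M)%:R * 4 <= e * n%:R :> R.
      have : (n %/ M)%:R * 4 <= (n %/ M)%:R * (M%:R * e) :> R.
        by rewrite ler_wpM2l// ltW.
      move=> /le_trans; apply; rewrite mulrA mulrC.
      by rewrite ler_pM2l.
    lra.
  have : (m - j * B)%:R <= a by apply: le_trans BR; rewrite ler_nat.
  move=> hm; apply: (le_trans (lerD (ltW hj) hm)).
  by rewrite /a -splitr.
Unshelve. all: by end_near. Qed.

Definition integrable01 (g : X -> R) : Prop :=
  Q0.-integrable [set: X] (EFin \o g) /\ Q1.-integrable [set: X] (EFin \o g).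

Lemma law_integrable (g : X -> R) n k :
  integrable01 g -> (law n k).-integrable [set: X] (EFin \o g).
Proof. by case=> g0 g1; rewrite /law; case: ifP. Qed.

Lemma integrable01_indic (A : set X) : measurable A -> integrable01 \1_A.
Proof. by move=> mA; split; exact: integrable_indic. Qed.

Lemma ulln_eq (g h : X -> R) : g =1 h -> ulln g -> ulln h.
Proof. by move=> /funext ->. Qed.

Lemma ullnD (g h : X -> R) : integrable01 g -> integrable01 h ->
  ulln g -> ulln h -> ulln (fun x => g x + h x).
Proof.
move=> ig ih ug uh e e0; have e20 : 0 < e / 2 by rewrite divr_gt0.
near=> p => m mp.
have -> : deviation (fun x => g x + h x) p.1 m p.2 =
    deviation g p.1 m p.2 + deviation h p.1 m p.2.
  rewrite /deviation -big_split; apply: eq_bigr => k _ /=.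
  rewrite RintegralD//; [ring|exact: law_integrable|exact: law_integrable].
rewrite (le_trans (ler_normD _ _))// [e]splitr mulrDl lerD//.
- by move: m mp; near: p; exact: ug.
- by move: m mp; near: p; exact: uh.
Unshelve. all: by end_near. Qed.

Lemma ullnZl (c : R) (g : X -> R) : integrable01 g ->
  ulln g -> ulln (fun x => c * g x).
Proof.
move=> ig ug e e0; have c0 : 0 < `|c| + 1 by rewrite ltr_wpDl.
have ec0 : 0 < e / (`|c| + 1) by rewrite divr_gt0.
near=> p => m mp.
have -> : deviation (fun x => c * g x) p.1 m p.2 = c * deviation g p.1 m p.2.
  rewrite /deviation mulr_sumr; apply: eq_bigr => k _ /=.
  by rewrite RintegralZl ?mulrBr//; exact: law_integrable.
have h : `|deviation g p.1 m p.2| <= e / (`|c| + 1) * p.1%:R.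
  by move: m mp; near: p; exact: ug.
rewrite normrM; apply: (@le_trans _ _ ((`|c| + 1) * (e / (`|c| + 1) * p.1%:R))).
  by apply: ler_pM => //; rewrite lerDl.
by rewrite mulrA mulrCA divff ?mulr1 ?gt_eqF.
Unshelve. all: by end_near. Qed.

Lemma integrable01_sum (I : eqType) (r : seq I) (f : I -> X -> R) :
  (forall i, integrable01 (f i)) ->
  integrable01 (fun x => \sum_(i <- r) f i x).
Proof.
by move=> fi; split; apply: integrable_EFin_sum => i; have [] := fi i.
Qed.

Lemma integrable01Zl (c : R) (g : X -> R) :
  integrable01 g -> integrable01 (fun x => c * g x).
Proof. by move=> [g0 g1]; split; exact: integrable_EFinZl. Qed.

Lemma integrable01B (g h : X -> R) :
  integrable01 g -> integrable01 h -> integrable01 (fun x => g x - h x).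
Proof. by move=> [g0 g1] [h0 h1]; split; exact: integrable_EFinB. Qed.

(** A simple function is a finite linear combination of indicators, and the law is stable under sums
    and multiples. *)
Lemma ulln_sfun (s : {sfun X >-> R}) : integrable01 s /\ ulln s.
Proof.
pose t : seq R := finmap.enum_fset (fset_set (range s)).
rewrite (_ : (s : X -> R) = fun x =>
    \sum_(i < size t) (t`_i * \1_(s @^-1` [set t`_i]) x)); last first.
  by apply/funext => x; rewrite fimfunEord.
have mA (i : 'I_(size t)) : measurable (s @^-1` [set t`_i]).
  by rewrite -[X in measurable X]setTI; exact: measurable_funPT.
split.
  by apply: integrable01_sum => i; exact/integrable01Zl/integrable01_indic.
elim: (index_enum _) => [|i r IH].
  (* The empty sum is written as a zero multiple of an indicator, so that the base case also reduces
     to [ulln_indic]. *)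
  apply: (@ulln_eq (fun x => 0 * \1_setT x)) => [x|].
    by rewrite big_nil mul0r.
  by apply: ullnZl; [exact: integrable01_indic|exact: ulln_indic].
apply: ulln_eq (ullnD _ _ (integrable01Zl _ _ (integrable01_indic _ (mA i)))
  _ (ullnZl _ _ (integrable01_indic _ (mA i)) (ulln_indic _ (mA i))) IH).
- by move=> x; rewrite big_cons.
- by apply: integrable01_sum => j; exact/integrable01Zl/integrable01_indic.
Qed.

(** The same simple function must serve both laws. Approximation in L1 of the sum measure [Q0] +
    [Q1] achieves this, as that error is the sum of the two individual ones. *)
Lemma sfun_approximation (g : X -> R) (delta : R) :
  integrable01 g -> 0 < delta ->
  exists s : {sfun X >-> R},
    \int[Q0]_x `|g x - s x| <= delta /\ \int[Q1]_x `|g x - s x| <= delta.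
Proof.
move=> [g0 g1] delta0.
pose mu := measure_add Q0 Q1.
have mg : measurable_fun [set: X] g.
  by apply/measurable_EFinP; exact: (measurable_int Q0).
have gmu : mu.-integrable [set: X] (EFin \o g).
  apply/integrableP; split; first exact/measurable_EFinP.
  rewrite ge0_integral_measure_add//; last first.
    by apply: measurableT_comp => //; exact/measurable_EFinP.
  by rewrite lte_add_pinfty//; [case/integrableP: g0|case/integrableP: g1].
have [s [si _ s0]] := approximation_sfun_integrable measurableT gmu.
move: s0 => /fine_cvgP[fin /cvgr0Pnorm_lt/(_ _ delta0) h].
have [N _ hN] := filterI fin h.
have [/= finN dN] := hN N (leqnn N).
exists (s N).
have ms : measurable_fun [set: X] (fun x => `|g x - s N x|).
  by apply: measurableT_comp => //; exact: measurable_funB.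
have E : (\int[mu]_x `|(EFin \o g) x - (s N x)%:E| =
   \int[Q0]_x `|g x - s N x|%:E + \int[Q1]_x `|g x - s N x|%:E)%E.
  by rewrite -ge0_integral_measure_add//; exact/measurable_EFinP.
have [s0 s1] : integrable01 (fun x => `|g x - s N x|).
  have [[s0 s1] _] := ulln_sfun (s N).
  by split; apply: integrable_norm; exact: integrable_EFinB.
move: dN; rewrite E !integral_fin_Rintegral//= => /ltW.
have n0 : 0 <= \int[Q0]_x `|g x - s N x| by exact: Rintegral_ge0.
have n1 : 0 <= \int[Q1]_x `|g x - s N x| by exact: Rintegral_ge0.
by move=> /(le_trans (ler_norm _)) h'; split; apply: le_trans h';
  rewrite ?lerDl ?lerDr.
Qed.

Lemma integral_obs (g : X -> R) n k : (1 <= k <= n)%N ->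
  integrable01 g -> (forall x, 0 <= g x) ->
  (\int[Pr]_w (g (obs n k w))%:E)%E = (\int[law n k]_x g x)%:E.
Proof.
move=> kn ig g0; have gi := law_integrable _ n k ig.
rewrite -integral_fin_Rintegral//.
rewrite -(@eq_measure_integral _ _ _ _ _ (distribution Pr (obs n k)));
  last first.
  by move=> A mA _; exact: (obs_law _ _ kn _ mA).
by rewrite ge0_integral_distribution//; exact: (measurable_int (law n k)).
Qed.

(* Markov's inequality absorbs the L1 error of approximating [g] by a simple
   function, so only first moments are needed. *)
Lemma ulln_integrable (g : X -> R) : integrable01 g -> ulln g.
Proof.
move=> ig e e0 eta eta0.
have e30 : 0 < e / 3 by rewrite divr_gt0.
have eta20 : 0 < eta / 2 by rewrite divr_gt0.
(* The two bounds have separate uses: [e / 3] controls the integrals of g - s, while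
   [e / 3 * (eta / 2)] makes Markov's bound equal to [eta / 2]. *)
have dl0 : 0 < Num.min (e / 3) (e / 3 * (eta / 2)).
  by rewrite lt_min e30 mulr_gt0.
have [s [s0 s1]] := sfun_approximation g _ ig dl0.
have [si us] := ulln_sfun s.
pose r x := `|g x - s x|.
have ir : integrable01 r.
  by have [? ?] := integrable01B _ _ ig si; split; exact: integrable_norm.
have lr n k : \int[law n k]_x r x <= Num.min (e / 3) (e / 3 * (eta / 2)).
  by rewrite /law; case: ifP.
near=> n.
have n0 : 0 < n%:R :> R by rewrite ltr0n; near: n; exists 1%N.
have [C [mC PC hC]] : exists C : set Omega,
    [/\ measurable C, (Pr C <= (eta / 2)%:E)%E & forall w, ~ C w ->
      forall m, (m <= n)%N -> `|deviation s n m w| <= e / 3 * n%:R].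
  by near: n; exact: us.
have mr : measurable_fun [set: X] r.
  by apply/measurable_EFinP; case: ir => /measurable_int.
(* Being a full sum of absolute values, [Y] dominates the approximation error of every partial sum
   at once. *)
pose Y w := \sum_(1 <= k < n.+1) r (obs n k w).
have mY : measurable_fun [set: Omega] Y.
  by apply: measurable_sum => k; exact: measurable_obs.
have [mD PD] : measurable [set w | e / 3 * n%:R <= Y w] /\
    (Pr [set w | (e / 3 * n%:R <= Y w)%R] <=
      ((e / 3 * (eta / 2) * n%:R) / (e / 3 * n%:R))%:E)%E.
  apply: markov_bound => //.
  - by move=> w; apply: sumr_ge0 => k _; exact: normr_ge0.
  - by rewrite mulr_gt0.
  - rewrite /Y; under eq_integral do rewrite -sumEFin.
    rewrite ge0_integral_sum//; first last.
    - by move=> k w _; rewrite lee_fin; exact: normr_ge0.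
    - by move=> k; apply/measurable_EFinP; exact: measurable_obs.
    apply: (@le_trans _ _ (\sum_(1 <= k < n.+1) (e / 3 * (eta / 2))%:E)%E).
      rewrite big_nat [leRHS]big_nat; apply: lee_sum => k kn.
      rewrite integral_obs//; last by move=> x; exact: normr_ge0.
      by rewrite lee_fin; have := lr n k; rewrite le_min => /andP[].
    by rewrite sumEFin big_const_nat iter_addr addr0 subn1 mulr_natr.
exists (C `|` [set w | e / 3 * n%:R <= Y w]); split.
- exact: measurableU.
- apply: (le_trans (measureU2 _ mC mD)); rewrite [eta]splitr EFinD leeD//.
  apply: (le_trans PD); rewrite lee_fin.
  by rewrite ler_pdivrMr ?mulr_gt0// [leRHS]mulrCA !mulrA.
- move=> w /= /not_orP[nC /negP]; rewrite -ltNge => Yw m mn.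
  (* Three terms, each at most [e / 3 * n%:R]: the deviation of [s], the sampled error g - s, and
     its expectation. *)
  have -> : deviation g n m w = deviation s n m w +
      \sum_(1 <= k < m.+1) (g (obs n k w) - s (obs n k w)) -
      \sum_(1 <= k < m.+1) \int[law n k]_x (g x - s x).
    rewrite /deviation -!(big_split, sumrB) /=; apply: eq_bigr => k _.
    rewrite RintegralB//; [ring|exact: law_integrable|exact: law_integrable].
  have h1 := hC w nC m mn.
  have h2 : `|\sum_(1 <= k < m.+1) (g (obs n k w) - s (obs n k w))| <= Y w.
    rewrite (le_trans (ler_norm_sum _ _ _))// /Y.
    rewrite [leRHS](big_cat_nat (n:=m.+1))//= lerDl.
    by apply: sumr_ge0 => k _; exact: normr_ge0.
  have h3 : `|\sum_(1 <= k < m.+1) \int[law n k]_x (g x - s x)| <=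
      e / 3 * n%:R.
    rewrite (le_trans (ler_norm_sum _ _ _))//.
    apply: (@le_trans _ _ (\sum_(1 <= k < m.+1) (e / 3))).
      apply: ler_sum => k _; rewrite (le_trans (le_normr_Rintegral _ _))//.
        by apply: law_integrable; exact: integrable01B.
      by have := lr n k; rewrite le_min => /andP[].
    rewrite big_const_nat iter_addr addr0 subn1 -[leLHS]mulr_natr.
    by rewrite ler_pM2l// ler_nat.
  rewrite (le_trans (ler_normB _ _))//.
  have := ler_normD (deviation s n m w)
    (\sum_(1 <= k < m.+1) (g (obs n k w) - s (obs n k w))).
  have := ltW Yw; lra.
Unshelve. all: by end_near. Qed.

End uniform_lln.

(** * Limits of determinants and inverse matrices along a filter *)

Section limits_along_filter.
Context {R : realType} {T : Type} {F : set_system T} {FF : Filter F}.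

Lemma cvg0_bounded_mul (b f : T -> R) (C : R) :
  (\forall p \near F, `|b p| <= C) -> f p @[p --> F] --> 0 ->
  b p * f p @[p --> F] --> 0.
Proof.
move=> bC f0; apply/cvgr0Pnorm_lt => e e0.
have C1 : 0 < `|C| + 1 by rewrite ltr_wpDl.
have eC : 0 < e / (`|C| + 1) by rewrite divr_gt0.
near=> p; rewrite normrM.
have bp : `|b p| <= `|C| + 1.
  apply: (@le_trans _ _ C); first by near: p.
  by rewrite (le_trans (ler_norm C))// lerDl.
have fp : `|f p| < e / (`|C| + 1) by near: p; exact: cvgr0_norm_lt.
rewrite (le_lt_trans (ler_pM _ _ bp (lexx _)))//.
by rewrite mulrC -ltr_pdivlMr.
Unshelve. all: by end_near. Qed.

(** The Leibniz expansion is a finite sum of finite products of entries. *)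
Lemma cvg_det n (A : T -> 'M[R]_n) (S : 'M[R]_n) :
  (forall i j, A p i j @[p --> F] --> S i j) ->
  \det (A p) @[p --> F] --> \det S.
Proof.
move=> AS; rewrite /determinant.
apply: cvg_big => [|s _]; first exact: add_continuous.
apply: cvgM; first exact: cvg_cst.
by apply: cvg_big => [|i _]; [exact: mul_continuous|exact: AS].
Qed.

Lemma cvg_cofactor n (A : T -> 'M[R]_n) (S : 'M[R]_n) i j :
  (forall i j, A p i j @[p --> F] --> S i j) ->
  cofactor (A p) i j @[p --> F] --> cofactor S i j.
Proof.
move=> AS; apply: cvgM; first exact: cvg_cst.
apply: cvg_det => k l; rewrite !mxE.
by under eq_cvg do rewrite !mxE; exact: AS.
Qed.

(** The adjugate formula is continuous where the determinant is nonzero. It describes [invmx (A p)]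
    only eventually, once [\det (A p)] is nonzero, which convergence to [\det S] provides. *)
Lemma cvg_invmx n (A : T -> 'M[R]_n) (S : 'M[R]_n) i j :
  S \in unitmx ->
  (forall i j, A p i j @[p --> F] --> S i j) ->
  invmx (A p) i j @[p --> F] --> invmx S i j.
Proof.
rewrite unitmxE unitfE => S0 AS; have dA := cvg_det _ _ _ AS.
have -> : invmx S i j = (\det S)^-1 * cofactor S j i.
  by rewrite /invmx unitmxE unitfE S0 !mxE.
have : (\det (A p))^-1 * cofactor (A p) j i @[p --> F] -->
    (\det S)^-1 * cofactor S j i.
  by apply: cvgM; [exact: cvgV|exact: cvg_cofactor].
apply: cvg_trans; apply: near_eq_cvg; near=> p.
rewrite /invmx unitmxE unitfE ifT ?mxE//.
near: p; exact: cvgr_neq0 dA S0.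
Unshelve. all: by end_near. Qed.

End limits_along_filter.

(** * Averages over an initial fraction of a sample with a change point *)

Lemma truncn_mul_le {R : realType} (v : R) (n : nat) :
  0 <= v <= 1 -> (Num.truncn (v * n%:R) <= n)%N.
Proof.
move=> /andP[v0 v1]; rewrite -[leqRHS](@natrK R).
by apply: le_truncn; rewrite ler_piMl.
Qed.

Lemma truncn_mul_itv {R : realType} (v : R) (n : nat) : 0 <= v ->
  v * n%:R - 1 <= (Num.truncn (v * n%:R))%:R <= v * n%:R.
Proof.
move=> v0; have vn : 0 <= v * n%:R by rewrite mulr_ge0.
have /andP[h1 h2] := truncn_itv vn; rewrite h1 andbT lerBlDr natr1 ltW//.
Qed.

Section change_point_average.
Context {R : realType} {dO dX : measure_display} {Omega : measurableType dO}.
Context {X : measurableType dX} {Pr : probability Omega R}.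
Variables (obs : nat -> nat -> {RV Pr >-> X}) (Q0 Q1 : probability X R).
Variable ustar : R.
Let K n : nat := Num.truncn (ustar * n%:R).
Hypothesis ustar01 : 0 < ustar < 1.
Hypothesis indep : forall n, independent_upto n (obs n).
Hypothesis obs_law : forall n k, (1 <= k <= n)%N ->
  forall A : set X, measurable A ->
  distribution Pr (obs n k) A = law Q0 Q1 K n k A.

(** The fraction [v] may depend on the sample size and on the outcome, so that the random [u_hat]
    can be substituted for it. *)
Definition average (g : X -> R) (v : nat * Omega -> R) (p : nat * Omega) : R :=
  p.1%:R^-1 *
  \sum_(1 <= k < (Num.truncn (v p * p.1%:R)).+1) g (obs p.1 k p.2).

(** The limit of [average g] at a fixed fraction [v]: the part of [0, [v]] before the change is
    weighted by [Q0], the remainder by [Q1]. *)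
Definition mixed_mean (g : X -> R) (v : R) : R :=
  Num.min v ustar * \int[Q0]_x g x + (v - Num.min v ustar) * \int[Q1]_x g x.

Lemma sum_law_Rintegral (g : X -> R) n m :
  \sum_(1 <= k < m.+1) \int[law Q0 Q1 K n k]_x g x =
  (minn m (K n))%:R * \int[Q0]_x g x +
  (m - minn m (K n))%:R * \int[Q1]_x g x.
Proof.
elim: m => [|m IH]; first by rewrite big_geq// min0n !mul0r addr0.
rewrite big_nat_recr//= IH /law; have [mK|] := boolP (m < K n)%N.
  rewrite (minn_idPl mK) (minn_idPl (ltnW mK)) !subnn -[in RHS]natr1; ring.
rewrite -leqNgt => mK; rewrite (minn_idPr mK) (minn_idPr (leqW mK)) subSn//.
by rewrite -[in RHS]natr1; ring.
Qed.

(** Rounding both arguments of a minimum down by at most 1 lowers the minimum by at most 1. *)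
Lemma minn_truncn_approx (v : R) (n : nat) : 0 <= v ->
  `|(minn (Num.truncn (v * n%:R)) (K n))%:R - Num.min v ustar * n%:R| <= 1.
Proof.
move=> v0; have u0 : 0 <= ustar by case/andP: ustar01 => /ltW.
have /andP[v1 v2] := truncn_mul_itv v n v0.
have /andP[u1 u2] := truncn_mul_itv ustar n u0.
rewrite natr_min minr_pMl// -/(K n) in u1 u2 *.
have min_approx (a b c d : R) : c - 1 <= a -> a <= c -> d - 1 <= b -> b <= d ->
    `|Num.min a b - Num.min c d| <= 1.
  by move=> *; rewrite ler_norml /Num.min; do 2 case: ltP => *;
    apply/andP; split; lra.
exact: min_approx.
Qed.

(** The uniform law controls the fluctuation at the random index; what remains is integer rounding,
    of order 1 / n. A difference is stated because [v p] itself need not converge. *)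
Lemma average_cvg (g : X -> R) (v : nat * Omega -> R) :
  integrable01 Q0 Q1 g ->
  (\forall p \near whp Pr, 0 <= v p <= 1) ->
  average g v p - mixed_mean g (v p) @[p --> whp Pr] --> 0.
Proof.
move=> ig v01; have ug := ulln_integrable _ _ _ _ indep obs_law _ ig.
apply/cvgr0Pnorm_le => e e0.
have e20 : 0 < e / 2 by rewrite divr_gt0.
set a0 := \int[Q0]_x g x; set a1 := \int[Q1]_x g x.
near=> p.
have vp : 0 <= v p <= 1 by near: p.
have v0 : 0 <= v p by case/andP: vp.
have D' : forall m, (m <= p.1)%N ->
    `|deviation obs Q0 Q1 K g p.1 m p.2| <= e / 2 * p.1%:R.
  by near: p; exact: (ug _ e20).
set n := p.1; set m := Num.truncn (v p * n%:R).
have n0 : 0 < n%:R :> R.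
  rewrite ltr0n /n; near: p; apply: (whp_at_infty Pr (fun n => 0 < n)%N).
  by exists 1%N.
(* Before division by n the rounding errors total at most |a0| + 2 |a1|, so this n makes them at
   most e n / 2. *)
have n1 : (`|a0| + 2 * `|a1|) / (e / 2) <= n%:R.
  rewrite /n; near: p.
  apply: (whp_at_infty Pr (fun n => (_ <= n%:R :> R))); exact: nbhs_infty_ger.
have mn : (m <= n)%N by exact: truncn_mul_le.
have D : `|deviation obs Q0 Q1 K g n m p.2| <= e / 2 * n%:R.
  exact: D'.
have hm := minn_truncn_approx (v p) n v0; rewrite -/m in hm.
have /andP[m1 m2] := truncn_mul_itv (v p) n v0; rewrite -/m in m1 m2.
(* Exact decomposition: the deviation, then the rounding of the number of observations before the
   change and of the number after it. *)
have E : average g v p - mixed_mean g (v p) =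
   n%:R^-1 * (deviation obs Q0 Q1 K g n m p.2 +
     ((minn m (K n))%:R - Num.min (v p) ustar * n%:R) * a0 +
     ((m%:R - v p * n%:R) -
       ((minn m (K n))%:R - Num.min (v p) ustar * n%:R)) * a1).
  rewrite /deviation sumrB sum_law_Rintegral natrB ?geq_minl//.
  rewrite /average -/n -/m /mixed_mean -/a0 -/a1; field; exact: lt0r_neq0.
rewrite E normrM normfV (ger0_norm (ltW n0)) mulrC ler_pdivrMr//.
move: hm; set x := _ - Num.min _ _ * _ => hm.
set y := m%:R - _.
have hy : `|y| <= 1 by rewrite ler_norml /y; apply/andP; split; lra.
have hx0 : `|x * a0| <= `|a0| by rewrite normrM ler_piMl.
have hy1 : `|(y - x) * a1| <= 2 * `|a1|.
  by rewrite normrM ler_wpM2r// (le_trans (ler_normB _ _))//; lra.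
move: n1; rewrite ler_pdivrMr// => n1.
have h1 := ler_normD (deviation obs Q0 Q1 K g n m p.2 + x * a0) ((y - x) * a1).
have h2 := ler_normD (deviation obs Q0 Q1 K g n m p.2) (x * a0).
lra.
Unshelve. all: by end_near. Qed.

End change_point_average.

(** * The limit covariance matrix and its kernel *)

Lemma measurable_neq0 {R : realType} {dX : measure_display}
    {X : measurableType dX} (g : X -> R) :
  measurable_fun [set: X] g -> measurable [set x | g x != 0].
Proof.
move=> mg.
rewrite (_ : [set x | _] = g @^-1` (~` [set 0])); last first.
  by apply/seteqP; split=> x /= /eqP.
by rewrite -[X in measurable X]setTI; apply: mg => //; exact: measurableC.
Qed.

Section limit_covariance.
Context {R : realType} {dX : measure_display} {X : measurableType dX} {d : nat}.
Variables (Q0 Q1 : probability X R) (psi : X -> 'cV[R]_d) (ustar : R).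
Hypothesis ustar01 : 0 < ustar < 1.
Hypothesis integrable_psi : forall i, integrable01 Q0 Q1 (fun x => psi x i 0).
Hypothesis integrable_psiM :
  forall i j, integrable01 Q0 Q1 (fun x => psi x i 0 * psi x j 0).

Local Notation mean g := (mixed_mean Q0 Q1 ustar g 1).

Lemma mixed_mean1 (g : X -> R) :
  mean g = ustar * \int[Q0]_x g x + (1 - ustar) * \int[Q1]_x g x.
Proof. by rewrite /mixed_mean min_r//; case/andP: ustar01 => _ /ltW. Qed.

Definition mean_limit : 'cV[R]_d := \col_i mean (fun x => psi x i 0).

Definition centered (x : X) : 'cV[R]_d := psi x - mean_limit.

(** The covariance matrix of [psi] under the mixture of [Q0] and [Q1] with weights [ustar] and
    [1 - ustar]. *)
Definition Sigma_limit : 'M[R]_d :=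
  \matrix_(i, j) mean (fun x => centered x i 0 * centered x j 0).

Definition lin_form (y : 'cV[R]_d) (x : X) : R := \sum_i y i 0 * centered x i 0.

(** The directions in which [psi] is degenerate under both laws. The lemmas below show that they are
    exactly the [y] with [y^T *m Sigma_limit = 0]. *)
Definition lin_form_null (y : 'cV[R]_d) : Prop :=
  Q0 [set x | lin_form y x != 0] = 0%E /\ Q1 [set x | lin_form y x != 0] = 0%E.

Lemma integrable01_cst (c : R) : integrable01 Q0 Q1 (fun=> c).
Proof. by split; exact: finite_measure_integrable_cst. Qed.

Lemma integrable01_eq (g h : X -> R) :
  g =1 h -> integrable01 Q0 Q1 g -> integrable01 Q0 Q1 h.
Proof. by move=> /funext ->. Qed.

Lemma integrable01_centered i : integrable01 Q0 Q1 (fun x => centered x i 0).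
Proof.
apply: (integrable01_eq _ _ _ (integrable01B _ _ _ _ (integrable_psi i)
  (integrable01_cst (mean_limit i 0)))).
by move=> x; rewrite !mxE.
Qed.

Lemma integrable01_centeredM i j :
  integrable01 Q0 Q1 (fun x => centered x i 0 * centered x j 0).
Proof.
set mi := mean_limit i 0; set mj := mean_limit j 0.
apply: (integrable01_eq _ _ _ (integrable01B _ _ _ _
  (integrable01B _ _ _ _ (integrable_psiM i j)
    (integrable01Zl _ _ mi _ (integrable_psi j)))
  (integrable01B _ _ _ _ (integrable01Zl _ _ mj _ (integrable_psi i))
    (integrable01_cst (mi * mj))))).
by move=> x; rewrite /centered !mxE -!/(mean_limit _ _) /mi /mj !mxE; ring.
Qed.

Lemma integrable01_lin_formM y j :
  integrable01 Q0 Q1 (fun x => lin_form y x * centered x j 0).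
Proof.
apply: (integrable01_eq (fun x =>
  \sum_i y i 0 * (centered x i 0 * centered x j 0))).
  by move=> x; rewrite mulr_suml; apply: eq_bigr => i _; rewrite mulrA.
by apply: integrable01_sum => i; exact/integrable01Zl/integrable01_centeredM.
Qed.

Lemma integrable01_lin_form y : integrable01 Q0 Q1 (lin_form y).
Proof.
by apply: integrable01_sum => i; exact/integrable01Zl/integrable01_centered.
Qed.

Lemma integrable01_lin_form_sq y :
  integrable01 Q0 Q1 (fun x => lin_form y x ^+ 2).
Proof.
apply: (integrable01_eq (fun x =>
  \sum_j y j 0 * (lin_form y x * centered x j 0))).
  move=> x; rewrite expr2 [in RHS]/lin_form mulr_sumr.
  by apply: eq_bigr => i _; rewrite mulrCA.
by apply: integrable01_sum => i; exact/integrable01Zl/integrable01_lin_formM.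
Qed.

Lemma mixed_mean_sum (I : eqType) (r : seq I) (c : I -> R) (g : I -> X -> R) :
  (forall i, integrable01 Q0 Q1 (g i)) ->
  mean (fun x => \sum_(i <- r) c i * g i x) = \sum_(i <- r) c i * mean (g i).
Proof.
move=> gi; rewrite mixed_mean1 !Rintegral_sum; last 2 first.
- by move=> i; apply: integrable_EFinZl; case: (gi i).
- by move=> i; apply: integrable_EFinZl; case: (gi i).
rewrite !mulr_sumr -big_split /=; apply: eq_bigr => i _.
have [g0 g1] := gi i.
by rewrite mixed_mean1 !RintegralZl//; ring.
Qed.

Lemma mulmx_Sigma_limit y j :
  (y^T *m Sigma_limit) 0 j = mean (fun x => lin_form y x * centered x j 0).
Proof.
rewrite (_ : (fun x => _) = fun x =>
    \sum_i y i 0 * (centered x i 0 * centered x j 0)); last first.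
  apply/funext => x; rewrite mulr_suml.
  by apply: eq_bigr => i _; rewrite mulrA.
rewrite mixed_mean_sum; last by move=> i; exact: integrable01_centeredM.
by rewrite !mxE; apply: eq_bigr => i _; rewrite !mxE.
Qed.

Lemma quadratic_Sigma_limit y :
  (y^T *m Sigma_limit *m y) 0 0 = mean (fun x => lin_form y x ^+ 2).
Proof.
rewrite (_ : (fun x => _) = fun x =>
    \sum_j y j 0 * (lin_form y x * centered x j 0)); last first.
  apply/funext => x; rewrite expr2 [in LHS]/lin_form mulr_sumr.
  by apply: eq_bigr => i _; rewrite mulrCA.
rewrite mixed_mean_sum; last by move=> i; exact: integrable01_lin_formM.
by rewrite mxE; apply: eq_bigr => i _; rewrite mulmx_Sigma_limit mulrC.
Qed.

Lemma Rintegral_sqr_eq0 (Q : probability X R) (g : X -> R) :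
  Q.-integrable [set: X] (EFin \o (fun x => g x ^+ 2)) ->
  measurable_fun [set: X] g ->
  \int[Q]_x (g x ^+ 2) = 0 -> Q [set x | g x != 0] = 0%E.
Proof.
move=> gi mg /eqP; rewrite -eqe -integral_fin_Rintegral// => /eqP g0.
have mN := measurable_neq0 _ mg.
have /(ae_eq_integral_abs _ measurableT (measurable_int Q gi)) :
    (\int[Q]_x `|(EFin \o (fun x => g x ^+ 2)%R) x| = 0)%E.
  by rewrite -[RHS]g0; apply: eq_integral => x _ /=; rewrite ger0_norm ?sqr_ge0.
move=> h; apply/eqP; rewrite eq_le measure_ge0 andbT.
have [N [mN' N0 hN]] := h; rewrite -N0; apply: le_measure; rewrite ?inE//.
move=> x /= gx; apply: hN => /= /(_ I) [] /eqP.
by rewrite sqrf_eq0 (negbTE gx).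
Qed.

Lemma Rintegral_null (Q : probability X R) (g h : X -> R) :
  measurable_fun [set: X] g -> measurable_fun [set: X] (fun x => g x * h x) ->
  Q [set x | g x != 0] = 0%E -> \int[Q]_x (g x * h x) = 0.
Proof.
move=> mg mgh g0.
have mN := measurable_neq0 _ mg.
rewrite /Rintegral (ae_eq_integral (cst 0%E))//.
- by rewrite integral0.
- exact/measurable_EFinP.
exists [set x | g x != 0]; split=> // x /= h'; apply/eqP => gx0; apply: h'.
by move=> _; rewrite gx0 mul0r.
Qed.

Lemma measurable_lin_form y : measurable_fun [set: X] (lin_form y).
Proof.
by apply/measurable_EFinP; have [/measurable_int] := integrable01_lin_form y.
Qed.

Lemma lin_form_null_mean y j : lin_form_null y -> (y^T *m Sigma_limit) 0 j = 0.
Proof.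
move=> [y0 y1]; rewrite mulmx_Sigma_limit mixed_mean1.
have mp := measurable_lin_form y.
have mpj : measurable_fun [set: X] (fun x => lin_form y x * centered x j 0).
  apply/measurable_EFinP.
  by have [/measurable_int] := integrable01_lin_formM y j.
by rewrite !Rintegral_null// !mulr0 addr0.
Qed.

Lemma quadratic_Sigma_limit_ge0 (y : 'cV[R]_d) :
  0 <= (y^T *m Sigma_limit *m y) 0 0.
Proof.
rewrite quadratic_Sigma_limit mixed_mean1; have /andP[u0 u1] := ustar01.
apply: addr_ge0; apply: mulr_ge0; rewrite ?subr_ge0 ?(ltW u0) ?(ltW u1)//;
  by apply: Rintegral_ge0 => x _; exact: sqr_ge0.
Qed.

(** The quadratic form is the mixture's second moment of [lin_form y]. Both weights are positive, so
    it vanishes only if the second moment under each law does. *)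
Lemma quadratic_Sigma_limit_eq0 (y : 'cV[R]_d) :
  (y^T *m Sigma_limit *m y) 0 0 = 0 -> lin_form_null y.
Proof.
rewrite quadratic_Sigma_limit mixed_mean1; have /andP[u0 u1] := ustar01.
have [i0 i1] := integrable01_lin_form_sq y.
have p0 : 0 <= \int[Q0]_x (lin_form y x ^+ 2).
  by apply: Rintegral_ge0 => x _; exact: sqr_ge0.
have p1 : 0 <= \int[Q1]_x (lin_form y x ^+ 2).
  by apply: Rintegral_ge0 => x _; exact: sqr_ge0.
have u1' : 0 < 1 - ustar by rewrite subr_gt0.
move=> /eqP; rewrite paddr_eq0 ?mulr_ge0 ?(ltW u0) ?(ltW u1')//.
rewrite !mulf_eq0 (gt_eqF u0) (gt_eqF u1')/= => /andP[/eqP h0 /eqP h1].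
by split; apply: Rintegral_sqr_eq0 => //; exact: measurable_lin_form.
Qed.

Let Delta : 'cV[R]_d :=
  \col_i (\int[Q0]_x psi x i 0 - \int[Q1]_x psi x i 0).

(** Integrating the null form under either law shows that the mean of [psi] has the same component
    along [y] as [mean_limit]; the two means therefore agree along [y]. *)
Lemma lin_form_null_orthogonal y : lin_form_null y -> (y^T *m Delta) 0 0 = 0.
Proof.
move=> [y0 y1].
have mp := measurable_lin_form y.
have E (Q : probability X R) :
    (forall i, Q.-integrable [set: X] (EFin \o (fun x => psi x i 0))) ->
    Q [set x | lin_form y x != 0] = 0%E ->
    \sum_i y i 0 * (\int[Q]_x psi x i 0) = \sum_i y i 0 * mean_limit i 0.
  move=> Qi Q0y; apply/eqP; rewrite -subr_eq0 -sumrB.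
  have := @Rintegral_null Q (lin_form y) (fun=> 1) mp.
  under [X in measurable_fun _ X]eq_fun do rewrite mulr1.
  under eq_Rintegral do rewrite mulr1.
  move=> /(_ mp Q0y) pQ; apply/eqP; rewrite -[RHS]pQ.
  have ic i : Q.-integrable [set: X] (EFin \o (fun x => centered x i 0)).
    rewrite (_ : (fun x => _) = fun x => psi x i 0 - mean_limit i 0).
      apply: integrable_EFinB => //; exact: finite_measure_integrable_cst.
    by apply/funext => x; rewrite !mxE.
  rewrite Rintegral_sum; last by move=> i; exact: integrable_EFinZl.
  apply: eq_bigr => i _; rewrite RintegralZl// -mulrBr; congr (_ * _).
  have -> : \int[Q]_x centered x i 0 =
      \int[Q]_x (psi x i 0 - mean_limit i 0).
    by apply: eq_Rintegral => x _; rewrite !mxE.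
  rewrite RintegralB//; last exact: finite_measure_integrable_cst.
  by rewrite Rintegral_cst_probability.
rewrite mxE; under eq_bigr do rewrite !mxE mulrBr.
rewrite sumrB !E ?subrr// => i; by have [] := integrable_psi i.
Qed.

End limit_covariance.

(** * Limit of the statistic and consistency of its maximiser *)

Section argmax_consistency.
Context {R : realType} {d : nat} {dX dO : measure_display}.
Context {X : measurableType dX} {Omega : measurableType dO}.
Context {Pr : probability Omega R}.
Variables (P : 'cV[R]_d -> probability X R) (psi : X -> 'cV[R]_d).
Variables (Theta : set 'cV[R]_d) (obs : nat -> nat -> {RV Pr >-> X}).
Variables (ustar : R) (theta0 theta1 : 'cV[R]_d).
Variable theta_hat : nat -> Omega -> 'cV[R]_d.
Let Q0 := P theta0.
Let Q1 := P theta1.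
Let K n : nat := Num.truncn (ustar * n%:R).
Hypothesis ustar01 : 0 < ustar < 1.
Hypothesis indep : forall n, independent_upto n (obs n).
Hypothesis obs_law : forall n k, (1 <= k <= n)%N ->
  forall A : set X, measurable A ->
  distribution Pr (obs n k) A = law Q0 Q1 K n k A.
Hypothesis integrable_psi : forall i, integrable01 Q0 Q1 (fun x => psi x i 0).
Hypothesis integrable_psiM :
  forall i j, integrable01 Q0 Q1 (fun x => psi x i 0 * psi x j 0).
Hypothesis theta_hatP : moment_estimator Theta P psi obs theta_hat.
Hypothesis moment01 : moment P psi theta0 != moment P psi theta1.

Let F := whp Pr.
Let e_hat (p : nat * Omega) : 'cV[R]_d := moment P psi (theta_hat p.1 p.2).
Let M := mean_limit Q0 Q1 psi ustar.
Let phi := centered Q0 Q1 psi ustar.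
Let S := Sigma_limit Q0 Q1 psi ustar.
Let S_hat (p : nat * Omega) : 'M[R]_d :=
  Sigma_hat P psi (fun k => obs p.1 k p.2) p.1 (theta_hat p.1 p.2).
Let avg := average obs.
Let one (p : nat * Omega) : R := 1.
Let Delta : 'cV[R]_d := moment P psi theta0 - moment P psi theta1.

Lemma near_pos : \forall p \near F, (0 < p.1)%N.
Proof. by apply: (whp_at_infty Pr (fun n => 0 < n)%N); exists 1%N. Qed.

Lemma one01 : \forall p \near F, 0 <= one p <= 1.
Proof. by apply: nearW => p; rewrite ler01 lexx. Qed.

Lemma averageE (g : X -> R) p :
  avg g one p = p.1%:R^-1 * \sum_(1 <= k < p.1.+1) g (obs p.1 k p.2).
Proof. by rewrite /avg /average mul1r natrK. Qed.

Lemma average_one_cvg (g : X -> R) : integrable01 Q0 Q1 g ->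
  avg g one p @[p --> F] --> mixed_mean Q0 Q1 ustar g 1.
Proof.
move=> ig; apply: cvg_zero.
exact: (average_cvg _ _ _ _ ustar01 indep obs_law _ _ ig one01).
Qed.

(** The equation Z_n(1, theta_hat) = 0 identifies e(theta_hat) with the sample mean, on the events
    where it is solved. *)
Lemma e_hat_average : \forall p \near F,
  forall i, e_hat p i 0 = avg (fun x => psi x i 0) one p.
Proof.
near=> p => i.
have n0 : p.1%:R != 0 :> R by rewrite pnatr_eq0 -lt0n; near: p; exact: near_pos.
have [_ /matrixP/(_ i 0)] : Theta (theta_hat p.1 p.2) /\
    Zn P psi (fun k => obs p.1 k p.2) p.1 1 (theta_hat p.1 p.2) = 0.
  by near: p; exact: whp_tending_to_1 theta_hatP.
rewrite averageE /Zn mul1r natrK !mxE summxE.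
under eq_bigr do rewrite !mxE.
rewrite sumrB big_const_nat iter_addr addr0 subn1 mulrBr => /eqP.
rewrite subr_eq0 => /eqP ->.
by rewrite -[X in _^-1 * X]mulr_natl mulrA mulVf// mul1r.
Unshelve. all: by end_near. Qed.

Lemma e_hat_cvg i : e_hat p i 0 @[p --> F] --> M i 0.
Proof.
have := average_one_cvg _ (integrable_psi i).
rewrite /M /mean_limit !mxE; apply: cvg_trans; apply: near_eq_cvg.
near=> p; apply/esym.
by move: i; near: p; exact: e_hat_average.
Unshelve. all: by end_near. Qed.

(** Equal to [v * (1 - ustar)] up to [ustar] and to [ustar * (1 - v)] after it: the covariance of a
    Brownian bridge, peaked at [ustar]. *)
Let tent (v : R) : R := Num.min v ustar - v * ustar.

Lemma Zn_cvg (v : nat * Omega -> R) i :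
  (\forall p \near F, 0 <= v p <= 1) ->
  Zn P psi (fun k => obs p.1 k p.2) p.1 (v p) (theta_hat p.1 p.2) i 0
    - tent (v p) * Delta i 0 @[p --> F] --> 0.
Proof.
move=> v01; pose g x : R := psi x i 0.
have c1 := average_cvg _ _ _ _ ustar01 indep obs_law _ _ (integrable_psi i) v01.
have c2 := average_cvg _ _ _ _ ustar01 indep obs_law _ _
  (integrable01_cst Q0 Q1 1) v01.
have c3 := e_hat_cvg i.
have c4 : v p * (e_hat p i 0 - M i 0) @[p --> F] --> 0.
  apply: (cvg0_bounded_mul _ _ 1).
    near=> p; have /andP[v0 v1] : 0 <= v p <= 1 by near: p.
    by rewrite ger0_norm.
  by rewrite -[X in _ --> X](subrr (M i 0)); apply: cvgB => //; exact: cvg_cst.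
(* Z_n is the partial average of [psi] minus e(theta_hat) times the average of 1. Replacing each
   factor by its limit leaves [mixed_mean] of [g] at [v p] minus [v p * M i 0], which is
   [tent (v p) * Delta i 0]. *)
have : (avg g v p - mixed_mean Q0 Q1 ustar g (v p))
    - (avg (fun=> 1) v p - mixed_mean Q0 Q1 ustar (fun=> 1) (v p)) * e_hat p i 0
    - v p * (e_hat p i 0 - M i 0) @[p --> F] --> 0 - 0 * M i 0 - 0.
  by apply: cvgB => //; apply: cvgB => //; exact: cvgM.
rewrite mul0r !subr0; apply: cvg_trans; apply: near_eq_cvg; apply: nearW => p.
have mu1 : mixed_mean Q0 Q1 ustar (fun=> 1) (v p) = v p.
  by rewrite /mixed_mean !Rintegral_cst_probability; ring.
have -> : Zn P psi (fun k => obs p.1 k p.2) p.1 (v p) (theta_hat p.1 p.2) i 0 =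
    avg g v p - avg (fun=> 1) v p * e_hat p i 0.
  rewrite /Zn mxE summxE.
  under eq_bigr do
    rewrite mxE [X in _ + X]mxE -[X in _ - X]mul1r.
  by rewrite sumrB -mulr_suml mulrBr mulrA.
rewrite mu1; have -> : Delta i 0 = \int[Q0]_x g x - \int[Q1]_x g x.
  by rewrite !mxE.
have -> : M i 0 = mixed_mean Q0 Q1 ustar g 1 by rewrite mxE.
rewrite mixed_mean1// /mixed_mean /tent; ring.
Unshelve. all: by end_near. Qed.

Lemma outer_product_mxE (v : 'cV[R]_d) i j : (v *m v^T) i j = v i 0 * v j 0.
Proof. by rewrite !mxE big_ord1 !mxE. Qed.

Lemma S_hat_cvg i j : S_hat p i j @[p --> F] --> S i j.
Proof.
have ci k := integrable01_centered _ _ _ ustar integrable_psi k.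
have c0 := average_one_cvg _ (integrable01_centeredM _ _ _ ustar
  integrable_psi integrable_psiM i j).
have c1 := average_one_cvg _ (ci i).
have c2 := average_one_cvg _ (ci j).
have c3 := average_one_cvg _ (integrable01_cst Q0 Q1 1).
have r0 k : e_hat p k 0 - M k 0 @[p --> F] --> 0.
  rewrite -[X in _ --> X](subrr (M k 0)); apply: cvgB; last exact: cvg_cst.
  exact: e_hat_cvg.
(* Recentering from e(theta_hat) to [M]: every correction term carries a factor [e_hat p - M], which
   tends to 0. *)
pose f p := avg (fun x => phi x i 0 * phi x j 0) one p
  - (e_hat p j 0 - M j 0) * avg (fun x => phi x i 0) one p
  - (e_hat p i 0 - M i 0) * avg (fun x => phi x j 0) one p
  + (e_hat p i 0 - M i 0) * (e_hat p j 0 - M j 0) * avg (fun=> 1) one p.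
have fS : f p @[p --> F] --> S i j.
  have -> : S i j =
      mixed_mean Q0 Q1 ustar (fun x => phi x i 0 * phi x j 0) 1
      - 0 * mixed_mean Q0 Q1 ustar (fun x => phi x i 0) 1
      - 0 * mixed_mean Q0 Q1 ustar (fun x => phi x j 0) 1
      + 0 * 0 * mixed_mean Q0 Q1 ustar (fun=> 1) 1.
    by rewrite [LHS]mxE !mul0r !subr0 addr0.
  apply: cvgD; last exact: cvgM (cvgM (r0 i) (r0 j)) c3.
  apply: cvgB; last exact: cvgM (r0 i) c2.
  by apply: cvgB; [exact: c0|exact: cvgM (r0 j) c1].
apply: cvg_trans fS; apply: near_eq_cvg; apply: nearW => p; rewrite /f.
pose v k := psi (obs p.1 k p.2) - moment P psi (theta_hat p.1 p.2).
have -> : S_hat p i j =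
    p.1%:R^-1 * \sum_(1 <= k < p.1.+1) (v k *m (v k)^T) i j.
  by rewrite /S_hat /Sigma_hat mxE summxE.
have E k : (v k *m (v k)^T) i j =
  phi (obs p.1 k p.2) i 0 * phi (obs p.1 k p.2) j 0
  - (e_hat p j 0 - M j 0) * phi (obs p.1 k p.2) i 0
  - (e_hat p i 0 - M i 0) * phi (obs p.1 k p.2) j 0
  + (e_hat p i 0 - M i 0) * (e_hat p j 0 - M j 0) * 1.
  have vE (a b : 'cV[R]_d) l : (a - b) l 0 = a l 0 - b l 0.
    by rewrite mxE [X in _ + X]mxE.
  rewrite outer_product_mxE /v /phi /centered -/M !vE -/(e_hat p); ring.
under [in RHS]eq_bigr do rewrite E.
rewrite big_split /= !sumrB -!mulr_sumr !averageE /=; ring.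
Qed.

(** For each n the exceptional set is a finite union of null events, since the bad set is null under
    both laws. *)
Lemma obs_lin_form_null (y : 'cV[R]_d) : lin_form_null Q0 Q1 psi ustar y ->
  \forall p \near F, forall k, (1 <= k <= p.1)%N ->
    lin_form Q0 Q1 psi ustar y (obs p.1 k p.2) = 0.
Proof.
move=> [y0 y1] eta eta0; apply: nearW => n.
pose N := [set x | lin_form Q0 Q1 psi ustar y x != 0].
have mN : measurable N.
  exact/measurable_neq0/(measurable_lin_form _ _ _ ustar integrable_psi y).
have mC k := measurable_obs_preimage obs n k N mN.
(* Observations are indexed from 1, hence the shift. *)
exists (\big[setU/set0]_(k < n) (obs n k.+1 @^-1` N)); split.
- by apply: bigsetU_measurable => k _.
- apply: (le_trans (Boole_inequality Pr (A := fun k => obs n k.+1 @^-1` N) _)).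
    by move=> k _.
  rewrite big1 ?lee_fin ?ltW// => k _.
  have kn : (1 <= k.+1 <= n)%N := ltn_ord k.
  by apply: etrans (obs_law _ _ kn _ mN) _; rewrite /law; case: ifP.
- move=> w nC k /= /andP[k1 kn]; apply/eqP; apply: contrapT => /negP h.
  apply: nC; rewrite -(bigcup_mkord n (fun k => obs n k.+1 @^-1` N)).
  exists k.-1 => /=; first by rewrite prednK.
  by rewrite prednK.
Qed.

Lemma S_hat_null (y : 'cV[R]_d) : lin_form_null Q0 Q1 psi ustar y ->
  \forall p \near F, y^T *m S_hat p = 0.
Proof.
move=> y0; near=> p.
have h : forall k, (1 <= k <= p.1)%N ->
    lin_form Q0 Q1 psi ustar y (obs p.1 k p.2) = 0.
  by near: p; exact: obs_lin_form_null.
have eE : forall i, e_hat p i 0 = avg (fun x => psi x i 0) one p.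
  by near: p; exact: e_hat_average.
have n0 : p.1%:R != 0 :> R by rewrite pnatr_eq0 -lt0n; near: p; exact: near_pos.
have vE (a b : 'cV[R]_d) l : (a - b) l 0 = a l 0 - b l 0.
  by rewrite mxE [X in _ + X]mxE.
(* The sum is the sample average of [lin_form y], whose terms all vanish. Thus [y] also annihilates
   each psi(X_k) - e(theta_hat). *)
have yM : \sum_i y i 0 * (e_hat p i 0 - M i 0) = 0.
  transitivity (p.1%:R^-1 * \sum_(1 <= k < p.1.+1)
      lin_form Q0 Q1 psi ustar y (obs p.1 k p.2)).
    rewrite /lin_form exchange_big mulr_sumr; apply: eq_bigr => i _ /=.
    rewrite -mulr_sumr mulrCA; congr (_ * _).
    under eq_bigr do rewrite vE.
    rewrite sumrB big_const_nat iter_addr addr0 subn1 mulrBr eE averageE.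
    by rewrite -[X in _ = _ - _^-1 * X]mulr_natl mulKf.
  by rewrite big_nat big1 ?mulr0// => k /h.
rewrite /S_hat /Sigma_hat -scalemxAr mulmx_sumr big_nat big1 ?scaler0// => k kn.
rewrite mulmxA (_ : y^T *m _ = 0) ?mul0mx//.
apply/matrixP => i j; rewrite !ord1 [in RHS]mxE mxE.
transitivity (lin_form Q0 Q1 psi ustar y (obs p.1 k p.2)
    - \sum_i y i 0 * (e_hat p i 0 - M i 0)).
  rewrite /lin_form -sumrB; apply: eq_bigr => l _.
  by rewrite mxE /centered !vE -/M -/(e_hat p); ring.
by rewrite yM h ?subr0.
Unshelve. all: by end_near. Qed.

Lemma invmx_S_hat_cvg : exists Q : 'M[R]_d,
  (forall i j, invmx (S_hat p) i j @[p --> F] --> Q i j) /\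
  0 < (Delta^T *m Q *m Delta) 0 0.
Proof.
have Delta0 : Delta != 0 by rewrite subr_eq0.
have DE : Delta = \col_i (\int[Q0]_x psi x i 0 - \int[Q1]_x psi x i 0).
  by apply/colP => i; rewrite !mxE.
have S_ge0 := quadratic_Sigma_limit_ge0 _ _ _ _ ustar01
  integrable_psi integrable_psiM.
have S_null := quadratic_Sigma_limit_eq0 _ _ _ _ ustar01
  integrable_psi integrable_psiM.
have null_S := lin_form_null_mean _ _ _ _ ustar01
  integrable_psi integrable_psiM.
have [Su|Su] := boolP (S \in unitmx).
  exists (invmx S); split=> [i j|]; first exact: cvg_invmx Su S_hat_cvg.
  (* Since S y = Delta, the form becomes y^T S y. If it were 0, [y] would be a null direction, so
     y^T S = 0, whence y = 0 and Delta = 0. *)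
  pose y := invmx S *m Delta.
  have yE : (Delta^T *m invmx S *m Delta) 0 0 = (y^T *m S *m y) 0 0.
    have Sy : S *m y = Delta by rewrite /y mulmxA mulmxV// mul1mx.
    have -> : y^T *m S *m y = (Delta^T *m y)^T.
      by rewrite [RHS]trmx_mul trmxK -mulmxA Sy.
    by rewrite [RHS]mxE /y mulmxA.
  rewrite yE lt_neqAle S_ge0 andbT eq_sym; apply/eqP => /S_null y0.
  have : y^T *m S = 0.
    by apply/rowP => j; rewrite [RHS]mxE; exact: null_S.
  move=> /(congr1 (mulmx^~ (invmx S))); rewrite mulmxK// mul0mx => yT0.
  have : y = 0 by rewrite -[y]trmxK yT0 trmx0.
  move=> /(congr1 (mulmx S)); rewrite /y mulmxA mulmxV// mul1mx mulmx0.
  by move/eqP; rewrite (negbTE Delta0).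
(* Singular case: a kernel vector of [S] also annihilates [S_hat], and [invmx] returns singular
   matrices unchanged. *)
exists S; split=> [i j|].
  apply: cvg_trans (S_hat_cvg i j); apply: near_eq_cvg.
  have : \det S == 0 by move: Su; rewrite unitmxE unitfE negbK.
  move=> /det0P[y y0 yS].
  have null_y : lin_form_null Q0 Q1 psi ustar y^T.
    by apply: S_null; rewrite trmxK yS mul0mx mxE.
  near=> p; rewrite /invmx ifF//; apply/negbTE.
  rewrite unitmxE unitfE negbK; apply/det0P; exists y => //.
  by rewrite -[y]trmxK; near: p; exact: S_hat_null.
(* A vanishing form would make [Delta] a null direction, hence orthogonal to itself. *)
rewrite lt_neqAle S_ge0 andbT eq_sym; apply/eqP => /S_null D0.
have := lin_form_null_orthogonal _ _ _ _ integrable_psi _ D0.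
rewrite -DE mxE; under eq_bigr do rewrite mxE -expr2.
move/eqP; rewrite psumr_eq0 => [|i _]; last exact: sqr_ge0.
move=> /allP D00; move/eqP: Delta0; apply; apply/colP => i.
by have := D00 i (mem_index_enum _); rewrite sqrf_eq0 => /eqP ->; rewrite mxE.
Unshelve. all: by end_near. Qed.

Lemma tent_ge0_le1 (v : R) : 0 <= v <= 1 -> 0 <= tent v <= 1.
Proof.
have /andP[u0 u1] := ustar01; move=> /andP[v0 v1]; rewrite /tent /Num.min.
by case: ltP => vu; apply/andP; split; nra.
Qed.

Lemma quadratic_mxE (x y : 'cV[R]_d) (A : 'M[R]_d) :
  (x^T *m A *m y) 0 0 = \sum_j \sum_i x i 0 * A i j * y j 0.
Proof.
rewrite mxE; apply: eq_bigr => j _; rewrite mxE mulr_suml.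
by apply: eq_bigr => i _; rewrite mxE.
Qed.

Let Zv (v : nat * Omega -> R) (p : nat * Omega) : 'cV[R]_d :=
  Zn P psi (fun k => obs p.1 k p.2) p.1 (v p) (theta_hat p.1 p.2).

Lemma quadratic_Zn_cvg (v : nat * Omega -> R) (Q : 'M[R]_d) :
  (\forall p \near F, 0 <= v p <= 1) ->
  (forall i j, invmx (S_hat p) i j @[p --> F] --> Q i j) ->
  ((Zv v p)^T *m invmx (S_hat p) *m Zv v p) 0 0
    - tent (v p) ^+ 2 * (Delta^T *m Q *m Delta) 0 0 @[p --> F] --> 0.
Proof.
move=> v01 SQ; pose r i p := Zv v p i 0 - tent (v p) * Delta i 0.
have r0 i : r i p @[p --> F] --> 0 := Zn_cvg v i v01.
have t1 : \forall p \near F, `|tent (v p)| <= 1.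
  near=> p; have /tent_ge0_le1/andP[t0 t1] : 0 <= v p <= 1 by near: p.
  by rewrite ger0_norm.
have t2 : \forall p \near F, `|tent (v p) ^+ 2| <= 1.
  near=> p; rewrite normrX exprn_ile1//; near: p; exact: t1.
(* The error at entry (i, j) after substituting Z_n = tent Delta + r. Each term contains [r] or
   [invmx (S_hat p) - Q], and [tent] is bounded. *)
pose g i j p := r i p * invmx (S_hat p) i j * r j p
  + tent (v p) * (Delta i 0 * invmx (S_hat p) i j * r j p
                  + r i p * invmx (S_hat p) i j * Delta j 0)
  + tent (v p) ^+ 2 * (Delta i 0 * (invmx (S_hat p) i j - Q i j) * Delta j 0).
have g0 i j : g i j p @[p --> F] --> 0.
  rewrite -[X in _ --> X](addr0 (0 : R)); apply: cvgD.
    rewrite -[X in _ --> X](addr0 (0 : R)); apply: cvgD.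
      rewrite -[X in _ --> X](mulr0 (0 * Q i j)).
      by apply: cvgM => //; exact: cvgM.
    apply: cvg0_bounded_mul t1 _.
    rewrite -[X in _ --> X](addr0 (0 : R)); apply: cvgD.
      rewrite -[X in _ --> X](mulr0 (Delta i 0 * Q i j)).
      by apply: cvgM => //; apply: cvgM => //; exact: cvg_cst.
    rewrite -[X in _ --> X](mul0r (Delta j 0)).
    apply: cvgM; last exact: cvg_cst.
    by rewrite -[X in _ --> X](mul0r (Q i j)); exact: cvgM.
  apply: cvg0_bounded_mul t2 _.
  rewrite -[X in _ --> X](mul0r (Delta j 0)); apply: cvgM; last exact: cvg_cst.
  rewrite -[X in _ --> X](mulr0 (Delta i 0)); apply: cvgM; first exact: cvg_cst.
  rewrite -[X in _ --> X](subrr (Q i j)).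
  by apply: cvgB => //; exact: cvg_cst.
have : \sum_j \sum_i g i j p @[p --> F] --> \sum_(j < d) \sum_(i < d) (0 : R).
  apply: cvg_big => [|j _]; first exact: add_continuous.
  by apply: cvg_big => [|i _]; [exact: add_continuous|exact: g0].
rewrite big1 => [|j _]; last by rewrite big1.
apply: cvg_trans; apply: near_eq_cvg; apply: nearW => p.
rewrite !quadratic_mxE mulr_sumr -sumrB; apply: eq_bigr => j _.
rewrite mulr_sumr -sumrB; apply: eq_bigr => i _.
by rewrite /g /r; ring.
Unshelve. all: by end_near. Qed.

(** With h the peak value, the piecewise linear tent satisfies h - tent v >= |ustar - v| h;
    multiplying by h + tent v >= h gives the bound for squares. *)
Lemma tent_sharp_max (v : R) : 0 <= v <= 1 ->
  `|ustar - v| * tent ustar ^+ 2 <= tent ustar ^+ 2 - tent v ^+ 2.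
Proof.
have /andP[u0 u1] := ustar01; move=> /andP[v0 v1].
have -> : tent ustar = ustar * (1 - ustar) by rewrite /tent minxx; ring.
set h := ustar * (1 - ustar).
have h0 : 0 < h by rewrite mulr_gt0// subr_gt0.
suff [t0 th] : 0 <= tent v /\ `|ustar - v| * h <= h - tent v.
  have ht : 0 <= h - tent v by apply: le_trans th; rewrite mulr_ge0// ltW.
  rewrite expr2 mulrA (le_trans (ler_wpM2r (ltW h0) th))//.
  by rewrite subr_sqr ler_wpM2l// lerDl.
rewrite /tent /h; case: (leP v ustar) => vu.
  (* The slack of the linear bound is exactly this product; on the other side of the peak it is
     [ustar * ustar * (v - ustar)]. *)
  have := mulr_ge0 (mulr_ge0 (_ : 0 <= ustar - v) (_ : 0 <= 1 - ustar))
    (_ : 0 <= 1 - ustar).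
  rewrite ger0_norm ?subr_ge0 ?(ltW u1)// => /(_ vu isT isT) h2.
  by split; nra.
have := mulr_ge0 (mulr_ge0 (ltW u0) (ltW u0)) (_ : 0 <= v - ustar).
rewrite ltr0_norm ?subr_lt0 ?subr_ge0 ?(ltW vu)// => /(_ isT) h2.
by split; nra.
Qed.

Lemma change_point_estimator_cvg (u_hat : nat -> {RV Pr >-> R}) :
  change_point_estimator P psi obs theta_hat u_hat ->
  u_hat p.1 p.2 @[p --> F] --> ustar.
Proof.
move=> u_hatP; have [Q [SQ q0]] := invmx_S_hat_cvg.
set q := (_ *m _) 0 0 in q0.
pose u (p : nat * Omega) : R := u_hat p.1 p.2.
pose us (p : nat * Omega) : R := ustar.
have us01 : \forall p \near F, 0 <= us p <= 1.
  by apply: nearW => p; have /andP[/ltW-> /ltW->] := ustar01.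
have u01 : \forall p \near F, 0 <= u p <= 1.
  near=> p; have n0 : (0 < p.1)%N by near: p; exact: near_pos.
  by have [] := u_hatP p.1 p.2 n0; rewrite in_itv.
pose T v p := ((Zv v p)^T *m invmx (S_hat p) *m Zv v p) 0 0.
have Tu := quadratic_Zn_cvg _ _ u01 SQ.
have Tus := quadratic_Zn_cvg _ _ us01 SQ.
have t0 : 0 < tent ustar.
  have /andP[h0 h1] := ustar01.
  by rewrite /tent minxx -[X in X - _]mulr1 -mulrBr mulr_gt0// subr_gt0.
apply/cvgrPdist_lt => e e0.
have tq0 : 0 < tent ustar ^+ 2 * q by rewrite mulr_gt0// exprn_gt0.
(* Half of the gap that the sharp maximum yields at distance [e]: one half is spent at [u p], the
   other at [ustar]. *)
have e'0 : 0 < e * (tent ustar ^+ 2 * q) / 2 by rewrite divr_gt0// mulr_gt0.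
near=> p.
have n0 : (0 < p.1)%N by near: p; exact: near_pos.
have up : 0 <= u p <= 1 by near: p.
have h1 : `|T u p - tent (u p) ^+ 2 * q| < e * (tent ustar ^+ 2 * q) / 2.
  by near: p; exact: cvgr0_norm_lt Tu _ e'0.
have h2 : `|T us p - tent ustar ^+ 2 * q| < e * (tent ustar ^+ 2 * q) / 2.
  by near: p; exact: cvgr0_norm_lt Tus _ e'0.
(* Maximality of [u_hat], with the positive factor n cancelled. The absolute values of the statistic
   remain and are compared with the nonnegative limits below. *)
have Tle : `|T us p| <= `|T u p|.
  have [_ /(_ ustar)] := u_hatP p.1 p.2 n0.
  have /andP[u0 u1] := ustar01; rewrite in_itv/= (ltW u0) (ltW u1) => /(_ isT).
  by rewrite /Tn !normrM ler_pM2l// normr_gt0 pnatr_eq0 -lt0n.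
have hu := tent_sharp_max _ up.
have a1 := ler_dist_dist (T u p) (tent (u p) ^+ 2 * q).
have a2 := ler_dist_dist (T us p) (tent ustar ^+ 2 * q).
have b1 : 0 <= tent (u p) ^+ 2 * q by rewrite mulr_ge0 ?sqr_ge0 ?ltW.
have b2 : 0 <= tent ustar ^+ 2 * q by rewrite mulr_ge0 ?sqr_ge0 ?ltW.
rewrite (ger0_norm b1) in a1; rewrite (ger0_norm b2) in a2.
have c1 := le_lt_trans a1 h1; have c2 := le_lt_trans a2 h2.
rewrite ltr_norml in c1; rewrite ltr_norml in c2.
have /andP[_ d1] := c1; have /andP[d2 _] := c2.
have hq : `|ustar - u p| * (tent ustar ^+ 2 * q) < e * (tent ustar ^+ 2 * q).
  rewrite mulrA (le_lt_trans (ler_wpM2r (ltW q0) hu))// mulrBl; lra.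
by rewrite -(ltr_pM2r tq0); exact: hq.
Unshelve. all: by end_near. Qed.

End argmax_consistency.

(** * From the moment model to the theorem *)

Lemma moment_model_integrableM {R : realType} {d : nat} {dX : measure_display}
    {X : measurableType dX} {mu : {measure set X -> \bar R}}
    {Theta : set 'cV[R]_d} {P : 'cV[R]_d -> probability X R}
    {f : 'cV[R]_d -> X -> R} {psi : X -> 'cV[R]_d} theta i j :
  moment_model mu Theta P f psi -> Theta theta ->
  (P theta).-integrable [set: X] (EFin \o (fun x => psi x i 0 * psi x j 0)).
Proof.
move=> model Ttheta; have mi := mm_mean model Ttheta.
have mij := mm_covariance model Ttheta i j.
set e := moment P psi theta in mij.
(* The raw product is the covariance integrand plus e_i psi_j + e_j psi_i - e_i e_j. *)
have h := integrable_EFinB _ _ _ (integrable_EFinD _ _ _ mij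
  (integrable_EFinD _ _ _ (integrable_EFinZl _ (e i 0) _ (mi j))
     (integrable_EFinZl _ (e j 0) _ (mi i))))
  (finite_measure_integrable_cst (P theta) (e i 0 * e j 0) measurableT).
move: h; congr (_.-integrable _ (EFin \o _)); apply/funext => x.
have vE l : (psi x - e) l 0 = psi x l 0 - e l 0.
  by rewrite mxE [X in _ + X]mxE.
by rewrite outer_product_mxE !vE /cst; ring.
Qed.

Theorem theorem4p9 (R : realType) (d : nat)
  (dX : measure_display) (X : measurableType dX)
  (mu : {measure set X -> \bar R}) (Theta : set 'cV[R]_d)
  (P : 'cV[R]_d -> probability X R) (f : 'cV[R]_d -> X -> R)
  (psi : X -> 'cV[R]_d)
  (model : moment_model mu Theta P f psi)
  (dO : measure_display) (Omega : measurableType dO)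
  (Pr : probability Omega R) (obs : nat -> nat -> {RV Pr >-> X})
  (ustar : R) (hustar : 0 < ustar < 1)
  (theta0 theta1 : 'cV[R]_d) (htheta0 : Theta theta0) (htheta1 : Theta theta1)
  (htheta01 : theta0 <> theta1)
  (H1 : change_point_alternative P obs ustar theta0 theta1)
  (theta_hat : nat -> Omega -> 'cV[R]_d)
  (htheta_hat : moment_estimator Theta P psi obs theta_hat)
  (u_hat : nat -> {RV Pr >-> R})
  (hu_hat : change_point_estimator P psi obs theta_hat u_hat) :
  cvg_in_probability u_hat ustar.
Proof.
apply: whp_cvg_in_probability.
apply: (change_point_estimator_cvg P psi Theta obs ustar theta0 theta1
  theta_hat) => //.
- exact: cp_indep H1.
- move=> n k kn A mA; rewrite /law; case: leqP => kK.
  + exact: (cp_before H1 kn kK mA).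
  + exact: (cp_after H1 kn kK mA).
- by move=> i; split; exact: mm_mean model _ _ i.
- by move=> i j; split; exact: (moment_model_integrableM _ _ _ model).
(* Identifiability: equal means would force equal parameters. *)
- by apply/eqP => /(mm_inj model htheta0 htheta1).
Qed.
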